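(* Let $r\ge1$, $s\ge0$ be integers, $\alpha_1,\ldots,\alpha_r\in\mathbb{C}$, $\beta_1,\ldots,\beta_s\in\mathbb{C}\setminus\mathbb{Z}_{\le0}$, $x\ge0$, $p\ge 0$ (with $\Re(\alpha_1)>0$ in case $p=x=0$), $t\in\mathbb{C}$ with $|t|<1$, $\lambda\in\mathbb{C}$, $N\in\mathbb{N}=\{1,2,\ldots\}$ and $z\in\mathbb{C}$. Each of the following holds, provided that each member of the respective equation exists: $$\sum_{n=0}^{\infty}\frac{(\lambda)_{n}}{n!}\;{}_{r+N}\Gamma_{s}\left[\begin{array}{r}\Delta(N;-n),(\alpha_{1},x;p),\alpha_{2},\ldots,\alpha_{r};\\ \beta_{1},\ldots,\beta_{s};\end{array} z\right]t^{n}=(1-t)^{-\lambda}\;{}_{r+N}\Gamma_{s}\left[\begin{array}{r}\Delta(N;\lambda),(\alpha_{1},x;p),\alpha_{2},\ldots,\alpha_{r};\\ \beta_{1},\ldots,\beta_{s};\end{array} z\left(-\frac{t}{1-t}\right)^{N}\right],$$ $$\sum_{n=0}^{\infty}\frac{(\lambda)_{n}}{n!}\;{}_{r+2N}\Gamma_{s}\left[\begin{array}{r}\Delta(N;-n),\Delta(N;\lambda+n),(\alpha_{1},x;p),\alpha_{2},\ldots,\alpha_{r};\\ \beta_{1},\ldots,\beta_{s};\end{array} z\right]t^{n}=(1-t)^{-\lambda}\;{}_{r+2N}\Gamma_{s}\left[\begin{array}{r}\Delta(2N;\lambda),(\alpha_{1},x;p),\alpha_{2},\ldots,\alpha_{r};\\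 \beta_{1},\ldots,\beta_{s};\end{array} z\left(-\frac{4t}{(1-t)^{2}}\right)^{N}\right],$$ and $$\sum_{n=0}^{\infty}\frac{(\lambda)_{n}}{n!}\;{}_{r+N}\Gamma_{s+N}\left[\begin{array}{r}\Delta(N;-n),(\alpha_{1},x;p),\alpha_{2},\ldots,\alpha_{r};\\ \Delta(N;1-\lambda-n),\beta_{1},\ldots,\beta_{s};\end{array} z\right]t^{n}=(1-t)^{-\lambda}\;{}_{r}\Gamma_{s}\left[\begin{array}{r}(\alpha_{1},x;p),\alpha_{2},\ldots,\alpha_{r};\\ \beta_{1},\ldots,\beta_{s};\end{array} zt^{N}\right].$$
   Context: Generalized incomplete Gamma function: $\Gamma(\nu,x;p):=\int_x^\infty u^{\nu-1}e^{-u-p/u}\,du$. Extended incomplete Pochhammer symbol: $[\lambda;x,p]_\nu:=\Gamma(\lambda+\nu,x;p)/\Gamma(\lambda)$, where $1/\Gamma(\lambda)$ is read as $0$ for $\lambda\in\mathbb{Z}_{\le0}$. Ordinary Pochhammer symbol: $(\lambda)_0=1$, $(\lambda)_n=\lambda(\lambda+1)\cdots(\lambda+n-1)$. $\Delta(N;\lambda)$ denotes the array of $N$ parameters $\frac{\lambda}{N},\frac{\lambda+1}{N},\ldots,\frac{\lambda+N-1}{N}$. Extended incomplete generalized hypergeometric function (when the series converges): for numerator parameters $a_1,\ldots,a_k$ listed together with the incomplete parameter $(\alpha_1,x;p)$ and $\alpha_2,\ldots,\alpha_r$ (the order of numerator parameters is irrelevant), and denominator parameters $b_1,\ldots,b_q\in\mathbb{C}\setminus\mathbb{Z}_{\le0}$,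 $${}_{r+k}\Gamma_{q}\left[\begin{array}{r}a_1,\ldots,a_k,(\alpha_{1},x;p),\alpha_{2},\ldots,\alpha_{r};\\ b_{1},\ldots,b_{q};\end{array} z\right]:=\sum_{m=0}^{\infty}\frac{(a_1)_m\cdots(a_k)_m\,[\alpha_{1};x,p]_{m}(\alpha_{2})_{m}\cdots(\alpha_{r})_{m}}{(b_{1})_{m}\cdots(b_{q})_{m}}\frac{z^{m}}{m!}.$$ $(1-t)^{-\lambda}$ is the principal branch. ''Each member exists'' means that all the functions involved are defined (in particular their denominator parameters are admissible) and all the series involved (the inner hypergeometric series for every $n$, the sum over $n$, and the series on the right) converge. *)

(* Defs.v *)
From HB Require Import structures.
From mathcomp Require Import all_boot all_order all_algebra.
From mathcomp Require Import complex.
From mathcomp Require Import all_classical all_reals all_analysis.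

Set Implicit Arguments.
Unset Strict Implicit.
Unset Printing Implicit Defensive.

Import Order.TTheory GRing.Theory Num.Theory.
Import numFieldNormedType.Exports.
Import ComplexField.Normc.

Local Open Scope classical_set_scope.
Local Open Scope ring_scope.
Local Open Scope complex_scope.

Section complex_functions.
Context {R : realType}.
Implicit Types (z a : R[i]) (u : nat -> R[i]).

(* The topology on R[i] is reached through the regular module R[i]^o. *)
Definition csummable u : Prop := cvgn (series (u : nat -> R[i]^o)).

(* Meaningful only when [csummable u]. *)
Definition csum u : R[i] := limn (series (u : nat -> R[i]^o)).

Definition cexp z : R[i] :=
  (expR (complex.Re z) * cos (complex.Im z)) +i*
  (expR (complex.Re z) * sin (complex.Im z)).

(* Principal argument, in ]-pi, pi], for z != 0. *)
Definition carg z : R :=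
  if complex.Im z < 0 then - acos (complex.Re z / normc z)
  else acos (complex.Re z / normc z).

Definition clog z : R[i] := ln (normc z) +i* carg z.

(* Principal branch of z^a, for z != 0. *)
Definition cpow z a : R[i] := cexp (a * clog z).

End complex_functions.

Section extended_incomplete_hypergeometric.
Context {R : realType}.
Implicit Types (nu lambda a b z : R[i]) (x p : R) (aa bb : seq R[i]).

Definition poch a (n : nat) : R[i] := \prod_(i < n) (a + i%:R).

Definition nonpos_int b : Prop := exists k : nat, b = - k%:R.

Definition igamma_integrand nu p (u : R) : R[i] :=
  cpow u%:C (nu - 1) * (expR (- u - p / u))%:C.

(* Gamma(nu, x; p); the integral of a complex-valued function is taken
   componentwise.  It is absolutely convergent for x, p >= 0, provided
   Re nu > 0 in case x = p = 0. *)
Definition igamma nu x p : R[i] :=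
  (\int[lebesgue_measure]_(u in `]x, +oo[) complex.Re (igamma_integrand nu p u))
  +i*
  (\int[lebesgue_measure]_(u in `]x, +oo[) complex.Im (igamma_integrand nu p u)).

(* A shift k with Re (lambda + k) > 0, equal to 0 if already Re lambda > 0. *)
Definition gamma_shift lambda : nat :=
  if 0 < complex.Re lambda then 0%N
  else (Num.truncn (- complex.Re lambda)).+1.

(* 1 / Gamma(lambda), where Gamma is Euler's integral Gamma(., 0; 0) on the
   half-plane Re > 0, extended to the other lambda by the functional equation
   Gamma(lambda + k) = (lambda)_k Gamma(lambda).  The Pochhammer factor makes
   this 0 at the poles 0, -1, -2, ... of Gamma. *)
Definition rgamma lambda : R[i] :=
  let k := gamma_shift lambda in
  poch lambda k / igamma (lambda + k%:R) 0 0.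

Lemma rgamma_pole (n : nat) : rgamma (- n%:R) = 0.
Proof.
have ReE : complex.Re (- n%:R : R[i]) = - n%:R by rewrite raddfN /= raddfMn.
rewrite /rgamma /gamma_shift ReE oppr_gt0 ltrn0 opprK natrK.
by rewrite /poch big_ord_recr /= addNr mulr0 mul0r.
Qed.

(* [lambda; x, p]_nu *)
Definition ipoch lambda x p nu : R[i] := igamma (lambda + nu) x p * rgamma lambda.

(* Delta(N; lambda) *)
Definition Delta (N : nat) lambda : seq R[i] :=
  [seq (lambda + j%:R) / N%:R | j <- iota 0 N].

(* aa collects all the numerator parameters other than (alpha1, x; p). *)
Definition eihg_term aa alpha1 x p bb z (m : nat) : R[i] :=
  (\prod_(a <- aa) poch a m) * ipoch alpha1 x p m%:R
  / (\prod_(b <- bb) poch b m) * (z ^+ m / m`!%:R).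

Definition eihg_exists aa alpha1 x p bb z : Prop :=
  (forall b, b \in bb -> ~ nonpos_int b) /\
  csummable (eihg_term aa alpha1 x p bb z).

Definition eihg aa alpha1 x p bb z : R[i] :=
  csum (eihg_term aa alpha1 x p bb z).

End extended_incomplete_hypergeometric.

(* Main.v *)
(* Write (mu)_n for the Pochhammer symbol, d = N, and b_mu(t) = sum_n (mu)_n t^n / n!,
   which is (1 - t)^(-mu).  The inner hypergeometric series terminate, and after
   (-n)_k = (-1)^k n! / (n - k)! all three identities take the form
     sum_n g_n t^n = b_lambda(t) * sum_m B_m y(t)^m,   y(t) = t^d / (1 - t)^(kappa d),
   with g_n = sum_(d m <= n) B_m (lambda + kappa d m)_(n - d m) / (n - d m)! and
   kappa = 1, 2, 0.  Near t = 0 this is an interchange of absolutely convergent sums.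
   Both sides are only assumed to converge at t itself, so one continues the identity
   along the segment [0, t[: |y| increases along it since |t| < 1 and kappa <= 2, hence
   both sides are locally sums of power series there, and the identity theorem applies.
   At t one concludes by Abel's theorem; y(s t) / y(t) tends to 1 within a Stolz angle
   as s -> 1, which makes it applicable to the series in y. *)
Require Import Defs.
From mathcomp Require Import all_boot all_order all_algebra.
From mathcomp Require Import complex.
From mathcomp Require Import all_classical all_reals all_analysis.
From mathcomp Require Import ring lra zify.

Set Implicit Arguments.
Unset Strict Implicit.
Unset Printing Implicit Defensive.

Import Order.TTheory GRing.Theory Num.Theory.
Import numFieldNormedType.Exports.
Import ComplexField.Normc.

Local Open Scope classical_set_scope.
Local Open Scope ring_scope.
Local Open Scope complex_scope.

(** * Convergence, absolute summability and interchange for complex series *)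

Section complex_series.
Context {R : realType}.
Implicit Types (u v : nat -> R[i]) (z w l : R[i]).

(** The double sum cannot simply be rearranged at t. Expanded around 0, its m-th term is majorised,
    up to a constant, by |B_m| times the m-th power of |t|^d / (1 - |t|)^(kappa d), whereas
    convergence on the right only controls |B_m| |y(t)|^m, and |1 - t| may well exceed 1 - |t|.
    Expanding around z with radius r replaces the ratio by (|z| + r)^d / (|1 - z| - r)^(kappa d),
    which tends to |y(z)| as r -> 0. Local expansions therefore exist wherever |y(z)| < |y(t)|,
    which is why the continuation runs through recentred series. At the endpoint, y(s t) / y(t) is
    in general not real, so the radial form of Abel's theorem does not suffice for the series in y.
    The factor (1 - t)^(-lambda) is handled as a binomial series throughout; a differential equation
    along the segment identifies it with the principal branch. The 4^N of the second identity is the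
    quotient of the scalings (2N)^(2N m) of Delta(2N; lambda) and N^(2N m) of two arrays Delta(N;
    .). *)

Lemma normcC z : `|z| = (normc z)%:C. Proof. by []. Qed.

Lemma normc_ge0 z : 0 <= normc z.
Proof. by rewrite -lecR -normcC normr_ge0. Qed.

Lemma normcX z n : normc (z ^+ n) = normc z ^+ n.
Proof. by elim: n => [|n IH]; rewrite ?expr0 ?normc1 // !exprS normcM IH. Qed.

Lemma normc_sum I (r : seq I) (P : pred I) (F : I -> R[i]) :
  normc (\sum_(i <- r | P i) F i) <= \sum_(i <- r | P i) normc (F i).
Proof.
elim/big_ind2 : _ => [|x a y b h1 h2|//]; first by rewrite normc0.
by rewrite (le_trans (le_normcD _ _)) // lerD.
Qed.

Lemma normcB z w : normc (z - w) = normc (w - z).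
Proof. by rewrite -normcN opprB. Qed.

Lemma normc_real (x : R) : normc x%:C = `|x|.
Proof. by rewrite /= expr0n addr0 sqrtr_sqr. Qed.

Lemma normc_nat n : normc (n%:R : R[i]) = n%:R.
Proof. by rewrite -(rmorph_nat (real_complex R)) normc_real normr_nat. Qed.

Lemma normc_gt0 z : (0 < normc z) = (z != 0).
Proof.
rewrite lt_neqAle normc_ge0 andbT eq_sym; congr (~~ _).
by apply/eqP/eqP => [/eq0_normc//|->]; rewrite normc0.
Qed.

Lemma normcD3 z w l : normc (z - l) <= normc (z - w) + normc (w - l).
Proof. by rewrite (le_trans _ (le_normcD _ _)) // addrA subrK. Qed.

Lemma ler_Re_normc z : `|complex.Re z| <= normc z.
Proof. by rewrite -lecR -normcC complex.normc_ge_Re. Qed.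

Lemma ler_Im_normc z : `|complex.Im z| <= normc z.
Proof.
case: z => a b /=; rewrite -sqrtr_sqr ler_sqrt ?lerDr ?sqr_ge0 //.
by rewrite addr_ge0 // sqr_ge0.
Qed.

Lemma normc_le_ReIm z : normc z <= `|complex.Re z| + `|complex.Im z|.
Proof.
case: z => a b /=; rewrite -[leRHS]ger0_norm ?addr_ge0 // -sqrtr_sqr.
rewrite ler_sqrt ?sqr_ge0 // -[a ^+ 2]real_normK ?num_real //.
rewrite -[b ^+ 2]real_normK ?num_real // sqrrD lerD2r lerDl.
by rewrite mulrn_wge0 // mulr_ge0.
Qed.

(** Convergence with a real epsilon and the real-valued [normc], so that estimates stay in the
    ordered field [R]; [ccvgP] relates it to the topology. *)
Definition ccvg u l := forall e : R, 0 < e ->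
  exists n0 : nat, forall n, (n0 <= n)%N -> normc (u n - l) < e.

Lemma ccvgP u l : ccvg u l <-> (u : nat -> R[i]^o) @ \oo --> (l : R[i]^o).
Proof.
split=> [h|/cvgrPdist_lt h].
  apply/cvgrPdist_lt => -[e e'] /=; rewrite ltcE /= => /andP[/eqP -> e0].
  have [n0 n0P] := h e e0; exists n0 => // n /= /n0P.
  by rewrite normcB -ltcR -normcC complexr0.
move=> e e0; have /h : 0 < e%:C :> R[i] by rewrite ltcR.
move=> [n0 _ n0P]; exists n0 => n /n0P /=.
by rewrite normcB normcC ltcR.
Qed.

Lemma ccvg_unique u l l' : ccvg u l -> ccvg u l' -> l = l'.
Proof. by move=> /ccvgP h /ccvgP h'; exact: (cvg_unique _ h h'). Qed.

Lemma ccvgD u v l l' : ccvg u l -> ccvg v l' -> ccvg (fun n => u n + v n) (l + l').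
Proof.
by move=> /ccvgP h /ccvgP h'; apply/ccvgP; exact: (cvgD h h').
Qed.

Lemma ccvgM u v l l' : ccvg u l -> ccvg v l' -> ccvg (fun n => u n * v n) (l * l').
Proof.
by move=> /ccvgP h /ccvgP h'; apply/ccvgP; exact: (@cvgM R[i] nat _ _ u v l l' h h').
Qed.

Lemma ccvg_eq u v l : (forall n, u n = v n) -> ccvg u l -> ccvg v l.
Proof. by move=> /funext ->. Qed.

Lemma ccvg_cst z : ccvg (fun=> z) z.
Proof. by move=> e e0; exists 0%N => n _; rewrite subrr normc0. Qed.

Definition has_csum u l := ccvg (fun n => \sum_(i < n) u i) l.

Lemma has_csumP u l : has_csum u l <-> csummable u /\ csum u = l.
Proof.
have E : (fun n => \sum_(i < n) u i) = series (u : nat -> R[i]^o).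
  by apply/funext => n; rewrite /series /= big_mkord.
rewrite /has_csum /csummable /csum E; split=> [/ccvgP h|[h <-]].
  by split; [apply/cvg_ex; exists l|exact: (cvg_lim (@norm_hausdorff _ _) h)].
by apply/ccvgP.
Qed.

Lemma csummable_has_csum u : csummable u -> has_csum u (csum u).
Proof. by move=> h; apply/has_csumP. Qed.

Lemma has_csum_csum u l : has_csum u l -> csum u = l.
Proof. by case/has_csumP. Qed.

Lemma has_csum_unique u l l' : has_csum u l -> has_csum u l' -> l = l'.
Proof. exact: ccvg_unique. Qed.

Lemma has_csum_eq u v l : (forall n, u n = v n) -> has_csum u l -> has_csum v l.
Proof. by move=> /funext ->. Qed.

Lemma has_csumD u v l l' :
  has_csum u l -> has_csum v l' -> has_csum (fun n => u n + v n) (l + l').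
Proof.
by move=> h h'; apply: ccvg_eq (ccvgD h h') => n; rewrite big_split.
Qed.

Lemma has_csumZ u l z : has_csum u l -> has_csum (fun n => z * u n) (z * l).
Proof.
move=> h; apply: ccvg_eq (ccvgM (ccvg_cst z) h) => n; by rewrite mulr_sumr.
Qed.

Lemma has_csumB u v l l' :
  has_csum u l -> has_csum v l' -> has_csum (fun n => u n - v n) (l - l').
Proof.
move=> h /(has_csumZ (-1)) h'; have := has_csumD h h'.
by rewrite mulN1r; apply: has_csum_eq => n; rewrite mulN1r.
Qed.

Lemma has_csum0 : has_csum (fun=> 0) 0.
Proof. by apply: ccvg_eq (ccvg_cst 0) => n; rewrite big1. Qed.

Lemma has_csum_finite u N :
  (forall n, (N <= n)%N -> u n = 0) -> has_csum u (\sum_(i < N) u i).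
Proof.
move=> h e e0; exists N => n Nn.
rewrite -(subnKC Nn) big_split_ord /= [X in _ + X - _]big1 => [|i _].
  by rewrite addr0 subrr normc0.
by rewrite h // leq_addr.
Qed.

Lemma has_csum_shift u l : has_csum u l ->
  has_csum (fun n => if n is n'.+1 then u n' else 0) l.
Proof.
move=> h e e0; have [n0 n0P] := h e e0; exists n0.+1 => -[//|n] nn0.
by rewrite big_ord_recl add0r; exact: n0P.
Qed.

Lemma has_csum_drop u l n :
  has_csum u l -> has_csum (fun i => u (n + i)%N) (l - \sum_(i < n) u i).
Proof.
move=> h e e0; have [n0 n0P] := h e e0; exists n0 => m nm.
have /n0P : (n0 <= n + m)%N by rewrite (leq_trans nm) // leq_addl.
by rewrite big_split_ord /= opprB addrA [X in normc (X - _)]addrC.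
Qed.

Lemma has_csum_addn u l n :
  has_csum u l -> has_csum (fun i => if (n <= i)%N then u (i - n)%N else 0) l.
Proof.
move=> h; elim: n => [|n IH].
  by apply: has_csum_eq h => n; rewrite subn0.
by apply: has_csum_eq (has_csum_shift IH) => -[|i].
Qed.

Lemma ccvg_bounded u l : ccvg u l -> exists M : R, forall n, normc (u n) <= M.
Proof.
move=> /(_ 1 ltr01)[n0 n0P].
exists (\sum_(i < n0) normc (u i) + (normc l + 1)) => n.
have [nn0|/n0P h] := ltnP n n0.
  rewrite (bigD1 (Ordinal nn0)) //= -addrA lerDl !addr_ge0 ?normc_ge0 //.
  by apply: sumr_ge0 => i _; exact: normc_ge0.
apply: (@le_trans _ _ (normc l + 1)).
  rewrite -[u n](subrK l) (le_trans (le_normcD _ _)) // addrC lerD2l ltW //.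
by rewrite lerDr; apply: sumr_ge0 => i _; exact: normc_ge0.
Qed.

(** Each term is a difference of two partial sums. This bound is what remains of a convergence
    hypothesis at t when working at interior points of the segment. *)
Lemma has_csum_bounded u l : has_csum u l ->
  exists2 M : R, 0 <= M & forall n, normc (u n) <= M.
Proof.
move=> /ccvg_bounded[M MP]; exists (M + M) => [|n].
  by rewrite addr_ge0 // (le_trans _ (MP 0%N)) // normc_ge0.
have -> : u n = \sum_(i < n.+1) u i - \sum_(i < n) u i.
  by rewrite big_ord_recr /= addrAC subrr add0r.
by rewrite (le_trans (le_normcD _ _)) // normcN lerD.
Qed.

Lemma ccvg_le u l (M : R) : ccvg u l -> (forall n, normc (u n) <= M) -> normc l <= M.
Proof.
move=> h uM; apply/ler_addgt0Pr => e /h[n0 /(_ n0 (leqnn _)) n0P].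
rewrite -[l](subrK (u n0)) (le_trans (le_normcD _ _)) // addrC lerD //.
by rewrite normcB ltW.
Qed.

(** Absolute summability with an explicit bound, kept as data because in a double series the row
    bounds are summed in turn. *)
Definition abs_bounded u (M : R) := forall n, \sum_(i < n) normc (u i) <= M.

Lemma has_csum_le u l M : has_csum u l -> abs_bounded u M -> normc l <= M.
Proof.
by move=> h uM; apply: ccvg_le h _ => n; rewrite (le_trans (normc_sum _ _ _)).
Qed.

Lemma sum_bounded_cvg (f : nat -> R) (M : R) : (forall n, 0 <= f n) ->
  (forall n, \sum_(i < n) f i <= M) -> cvgn (series f).
Proof.
move=> f0 fM; apply: nondecreasing_is_cvgn.
  by apply: nondecreasing_series => n _ _; exact: f0.
by exists M => _ [n _ <-]; rewrite /series /= big_mkord.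
Qed.

Lemma abs_bounded_has_csum u M : abs_bounded u M -> has_csum u (csum u).
Proof.
move=> uM; suff [l hl] : exists l, has_csum u l by rewrite (has_csum_csum hl).
have cn := sum_bounded_cvg (fun n => normc_ge0 (u n)) uM.
have part (f : R[i] -> R) : (forall z, `|f z| <= normc z) ->
    exists l : R, series (f \o u) @ \oo --> l.
  move=> fP; apply/cvg_ex; apply: normed_cvg.
  apply: (@series_le_cvg _ _ (fun n => normc (u n))) => // n /=.
  - exact: normr_ge0.
  - exact: normc_ge0.
  - exact: fP.
have [a /cvgrPdist_lt ha] := part _ ler_Re_normc.
have [b /cvgrPdist_lt hb] := part _ ler_Im_normc.
exists (a +i* b) => e e0; have e20 : 0 < e / 2 by rewrite divr_gt0.
have [n1 _ n1P] := ha _ e20; have [n2 _ n2P] := hb _ e20.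
exists (maxn n1 n2) => n; rewrite geq_max => /andP[/n1P /= h1 /n2P /= h2].
rewrite normcB (le_lt_trans (normc_le_ReIm _)) // [ltRHS](splitr e).
rewrite ltrD // raddfB /= raddf_sum.
  by move: h1; rewrite /series /= big_mkord.
by move: h2; rewrite /series /= big_mkord.
Qed.

Lemma sum_bounded_tail (f : nat -> R) (M e : R) : (forall n, 0 <= f n) ->
  (forall n, \sum_(i < n) f i <= M) -> 0 < e ->
  exists n0 : nat, forall n, \sum_(i < n) f (n0 + i)%N <= e.
Proof.
move=> f0 /(sum_bounded_cvg f0)/cvg_ex[l /cvgrPdist_lt hl] e0.
have [n0 _ n0P] := hl _ (divr_gt0 e0 (ltr0n R 2)).
exists n0 => n; have := n0P n0 (leqnn _); have := n0P (n0 + n)%N (leq_addr _ _).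
rewrite /= /series /= !big_mkord big_split_ord /= => h1 h2.
move: h1 h2; rewrite !ltr_norml; lra.
Qed.

(** Dominated convergence for series: beyond some [k0] the tails of all [U n] and of [V] are at most
    e/4, and the finite head converges termwise. *)
Lemma tannery (U : nat -> nat -> R[i]) (V : nat -> R[i]) (B : nat -> R) (M : R)
    (L : nat -> R[i]) l :
  (forall n k, normc (U n k) <= B k) -> (forall n, \sum_(i < n) B i <= M) ->
  (forall k, ccvg (U ^~ k) (V k)) ->
  (forall n, has_csum (U n) (L n)) -> has_csum V l -> ccvg L l.
Proof.
move=> UB BM UV hL hl e e0.
have B0 k : 0 <= B k by rewrite (le_trans _ (UB 0%N k)) // normc_ge0.
have VB k : normc (V k) <= B k by apply: ccvg_le (UV k) _ => n; exact: UB.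
have e40 : 0 < e / 4 by rewrite divr_gt0.
have [k0 k0P] := sum_bounded_tail B0 BM e40.
have hU : ccvg (fun n => \sum_(k < k0) (U n k - V k)) 0.
  elim: (k0) => [|k IH].
    by apply: ccvg_eq (ccvg_cst 0) => n; rewrite big_ord0.
  have h : ccvg (fun n => U n k - V k) 0.
    by rewrite -(subrr (V k)); apply: ccvgD => //; exact: ccvg_cst.
  have := ccvgD IH h; rewrite addr0; apply: ccvg_eq => n.
  by rewrite [RHS]big_ord_recr.
have tl (W : nat -> R[i]) w : (forall k, normc (W k) <= B k) -> has_csum W w ->
    normc (w - \sum_(k < k0) W k) <= e / 4.
  move=> WB /(has_csum_drop k0) hW; apply: has_csum_le hW _ => n.
  by rewrite (le_trans _ (k0P n)) // ler_sum.
have [n0 n0P] := hU _ e40; exists n0 => n /n0P; rewrite subr0 sumrB => h.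
have -> : L n - l = (L n - \sum_(k < k0) U n k) +
    (\sum_(k < k0) U n k - \sum_(k < k0) V k) - (l - \sum_(k < k0) V k).
  by ring.
have := tl _ _ (UB n) (hL n); have := tl _ _ VB hl => h1 h2.
have := le_normcD (L n - \sum_(k < k0) U n k +
    (\sum_(k < k0) U n k - \sum_(k < k0) V k)) (- (l - \sum_(k < k0) V k)).
have := le_normcD (L n - \sum_(k < k0) U n k)
    (\sum_(k < k0) U n k - \sum_(k < k0) V k).
rewrite normcN; lra.
Qed.

(** Fubini for double series: partial row sums are dominated by the row bounds [B], so Tannery's
    theorem lets the number of columns tend to infinity. *)
Lemma csum_exchange (a : nat -> nat -> R[i]) (B : nat -> R) (M : R)
    (r c : nat -> R[i]) l :
  (forall j, abs_bounded (a j) (B j)) -> (forall n, \sum_(i < n) B i <= M) ->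
  (forall j, has_csum (a j) (r j)) -> (forall n, has_csum (a ^~ n) (c n)) ->
  has_csum r l -> has_csum c l.
Proof.
move=> aB BM ar ac rl.
apply: (@tannery (fun m j => \sum_(n < m) a j n) r B M) => // [m j|m].
  exact: le_trans (normc_sum _ _ _) (aB j m).
elim: m => [|m IH].
  rewrite big_ord0; apply: has_csum_eq has_csum0 => j; by rewrite /= big_ord0.
rewrite big_ord_recr /=; apply: has_csum_eq (has_csumD IH (ac m)) => j.
by rewrite big_ord_recr.
Qed.

Lemma abs_bounded_term u M n : abs_bounded u M -> normc (u n) <= M.
Proof.
move=> /(_ n.+1); rewrite big_ord_recr; apply: le_trans.
by rewrite lerDr; apply: sumr_ge0 => i _; exact: normc_ge0.
Qed.

Lemma abs_bounded_column (a : nat -> nat -> R[i]) (B : nat -> R) (M : R) n :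
  (forall j, abs_bounded (a j) (B j)) -> (forall m, \sum_(i < m) B i <= M) ->
  abs_bounded (a ^~ n) M.
Proof.
move=> aB BM m; rewrite (le_trans _ (BM m)) // ler_sum // => i _.
exact: abs_bounded_term.
Qed.

(** Abel's lemma: the terms have a geometric majorant of ratio X/Y, whose sum is C / (1 - X/Y). *)
Lemma geometric_abs_bounded u (C X Y : R) : 0 <= X < Y ->
  (forall n, normc (u n) * Y ^+ n <= C) ->
  forall n, \sum_(i < n) normc (u i) * X ^+ i <= C * Y / (Y - X).
Proof.
move=> /andP[X0 XY] uC n.
have Y0 : 0 < Y by exact: le_lt_trans XY.
have q1 : X / Y < 1 by rewrite ltr_pdivrMr ?mul1r.
have q0 : 0 <= X / Y by rewrite divr_ge0 // ltW.
apply: (@le_trans _ _ (\sum_(i < n) C * (X / Y) ^+ i)).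
  apply: ler_sum => i _; rewrite expr_div_n mulrA ler_pdivlMr ?exprn_gt0 //.
  by rewrite mulrAC ler_wpM2r // exprn_ge0.
have C0 : 0 <= C.
  by rewrite (le_trans _ (uC 0%N)) // mulr_ge0 ?normc_ge0 // exprn_ge0 // ltW.
rewrite -mulr_sumr -mulrA; apply: ler_wpM2l => //.
have -> : Y / (Y - X) = (1 - X / Y)^-1.
  by field; rewrite ?subr_eq0 !gt_eqF //; lra.
rewrite -[leRHS]mul1r ler_pdivlMr ?subr_gt0 //.
rewrite mulrC -opprB mulNr -subrX1 opprB.
by rewrite gerBl exprn_ge0.
Qed.

End complex_series.

Section binomial_series.
Context {R : realType}.
Implicit Types (mu z h : R[i]) (a c : nat -> R[i]).

Lemma poch0 mu : poch mu 0 = 1.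
Proof. by rewrite /poch big_ord0. Qed.

Lemma pochS mu n : poch mu n.+1 = poch mu n * (mu + n%:R).
Proof. by rewrite /poch big_ord_recr. Qed.

Lemma pochD mu m n : poch mu (m + n) = poch mu m * poch (mu + m%:R) n.
Proof.
elim: n => [|n IH]; first by rewrite addn0 poch0 mulr1.
by rewrite addnS !pochS IH natrD !mulrA addrA.
Qed.

Lemma pochSl mu n : poch mu n.+1 = mu * poch (mu + 1) n.
Proof. by rewrite -add1n pochD pochS poch0 mul1r addr0. Qed.

Lemma fact_neq0 (F : numDomainType) n : n`!%:R != 0 :> F.
Proof. by rewrite pnatr_eq0 -lt0n fact_gt0. Qed.

Definition bincoef mu n : R[i] := poch mu n / n`!%:R.

Lemma bincoef0 mu : bincoef mu 0 = 1.
Proof. by rewrite /bincoef poch0 fact0 divr1. Qed.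

(** Pascal's rule, the coefficient form of (1 - X) (1 - X)^(-mu-1) = (1 - X)^(-mu). *)
Lemma bincoefS mu n :
  bincoef (mu + 1) n.+1 = bincoef (mu + 1) n + bincoef mu n.+1.
Proof.
have f0 := fact_neq0 R[i] n; have n0 : n.+1%:R != 0 :> R[i] by rewrite pnatr_eq0.
rewrite /bincoef pochS pochSl factS natrM -!natr1.
by field; rewrite f0 natr1.
Qed.

(** Coefficient form of the m-th derivative, divided by m!, of (1 - X)^(-mu), which is (mu)_m / m!
    times (1 - X)^(-mu-m). It identifies the recentred binomial series. *)
Lemma bincoefM mu m n :
  bincoef mu (m + n) * 'C(m + n, m)%:R = bincoef mu m * bincoef (mu + m%:R) n.
Proof.
have := bin_fact (leq_addr n m); rewrite addKn => E.
rewrite /bincoef pochD -E !natrM.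
have C0 : 'C(m + n, m)%:R != 0 :> R[i] by rewrite pnatr_eq0 -lt0n bin_gt0 leq_addr.
by field; rewrite C0 !fact_neq0.
Qed.

(* Coefficients of [(1 - X) ^- j]. *)
Definition nbincoef (j n : nat) : R := \prod_(i < n) (j + i)%:R / n`!%:R.

Lemma nbincoef_ge0 j n : 0 <= nbincoef j n.
Proof. by rewrite divr_ge0 ?ler0n // prodr_ge0. Qed.

Lemma nbincoefS j n :
  nbincoef j.+1 n.+1 = nbincoef j.+1 n + nbincoef j n.+1.
Proof.
have f0 := fact_neq0 R n; have n0 : n.+1%:R != 0 :> R by rewrite pnatr_eq0.
rewrite /nbincoef big_ord_recr [in X in _ = _ + X]big_ord_recl /= addn0.
have -> : \prod_(i < n) (j + lift ord0 i)%:R = \prod_(i < n) (j.+1 + i)%:R :> R.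
  by apply: eq_bigr => i _; rewrite lift0 addnS.
rewrite factS natrM natrD -!natr1.
by field; rewrite f0 natr1.
Qed.

(** Since |mu + i| <= j + i, a natural number j above |mu| yields a nonnegative majorant whose sum
    involves only a natural power of 1 - q. *)
Lemma normc_bincoef_le mu j n : normc mu <= j%:R ->
  normc (bincoef mu n) <= nbincoef j n.
Proof.
move=> muj; rewrite /bincoef /nbincoef normcM normcV normc_nat.
rewrite ler_wpM2r ?invr_ge0 ?ler0n //.
elim: n => [|n IH]; first by rewrite poch0 big_ord0 normc1.
rewrite pochS big_ord_recr normcM /= ler_pM ?normc_ge0 //.
by rewrite (le_trans (le_normcD _ _)) // natrD lerD // normc_nat.
Qed.

(** Pascal's rule bounds the sum S_(j+1) by q S_(j+1) + S_j, so each increment of j costs a factor 1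
    / (1 - q). *)
Lemma nbincoef_sum_le j (q : R) m : 0 <= q < 1 ->
  \sum_(n < m) nbincoef j n * q ^+ n <= (1 - q) ^- j.
Proof.
move=> /andP[q0 q1]; have q1' : 0 < 1 - q by rewrite subr_gt0.
have ge0 i n : 0 <= nbincoef i n * q ^+ n.
  by rewrite mulr_ge0 ?nbincoef_ge0 ?exprn_ge0.
have S0 i n : 0 <= \sum_(l < n) nbincoef i l * q ^+ l by rewrite sumr_ge0.
(* One more term is summed so that the zeroth one can be split off. *)
suff : \sum_(n < m.+1) nbincoef j n * q ^+ n <= (1 - q) ^- j.
  by apply: le_trans; rewrite big_ord_recr /= lerDl.
elim: j => [|j IH].
  rewrite big_ord_recl big1 => [|i _]; last first.
    by rewrite /nbincoef big_ord_recl !mul0r.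
  by rewrite /nbincoef big_ord0 fact0 !expr0 invr1 mulr1 mulr1 addr0.
rewrite exprS invfM ler_pdivlMl //; apply: le_trans IH.
have E : \sum_(n < m.+1) nbincoef j.+1 n * q ^+ n =
    q * (\sum_(n < m) nbincoef j.+1 n * q ^+ n) +
    \sum_(n < m.+1) nbincoef j n * q ^+ n.
  rewrite big_ord_recl [X in _ = _ + X]big_ord_recl addrCA mulr_sumr -big_split.
  congr (_ + _); first by rewrite /nbincoef !big_ord0.
  apply: eq_bigr => i _; rewrite /= /bump leq0n add1n nbincoefS exprS; ring.
rewrite mulrBl mul1r lerBlDl {1}E lerD2r ler_wpM2l //.
by rewrite [leRHS]big_ord_recr lerDl.
Qed.

Definition bounded_at a (r M : R) :=
  forall m, \sum_(n < m) normc (a n) * r ^+ n <= M.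

Lemma bounded_at_abs a r M h : bounded_at a r M -> normc h <= r ->
  abs_bounded (fun n => a n * h ^+ n) M.
Proof.
move=> aM hr m; rewrite (le_trans _ (aM m)) // ler_sum // => i _.
by rewrite normcM normcX ler_wpM2l ?normc_ge0 // lerXn2r ?nnegrE ?normc_ge0 //
  (le_trans (normc_ge0 h)).
Qed.

Lemma bincoef_bounded mu j (q : R) : normc mu <= j%:R -> 0 <= q < 1 ->
  bounded_at (bincoef mu) q ((1 - q) ^- j).
Proof.
move=> muj /[dup] q01 /andP[q0 _] m.
rewrite (le_trans _ (nbincoef_sum_le j m q01)) // ler_sum // => i _.
by rewrite ler_wpM2r ?exprn_ge0 // normc_bincoef_le.
Qed.

(** Stands for (1 - z)^(-mu) until [binseries_cpow] identifies it with the principal branch. *)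
Definition binseries mu z : R[i] := csum (fun n => bincoef mu n * z ^+ n).

Lemma normc_le_nat z : exists j : nat, normc z <= j%:R.
Proof.
by exists (Num.truncn (normc z)).+1; rewrite ltW // truncnS_gt.
Qed.

Lemma binseriesP mu z : normc z < 1 ->
  has_csum (fun n => bincoef mu n * z ^+ n) (binseries mu z).
Proof.
move=> z1; have [j muj] := normc_le_nat mu.
have z01 : 0 <= normc z < 1 by rewrite normc_ge0.
exact: abs_bounded_has_csum (bounded_at_abs (bincoef_bounded muj z01) (lexx _)).
Qed.

Lemma binseries0 mu : binseries mu 0 = 1.
Proof.
apply: has_csum_csum.
have := @has_csum_finite R (fun n => bincoef mu n * 0 ^+ n) 1%N.
rewrite big_ord1 bincoef0 expr0 mulr1; apply => -[//|n] _.
by rewrite expr0n mulr0.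
Qed.

Lemma binseriesS mu z : normc z < 1 ->
  (1 - z) * binseries (mu + 1) z = binseries mu z.
Proof.
move=> z1; have h1 := binseriesP (mu + 1) z1.
have h2 := has_csumZ z (has_csum_shift h1).
rewrite mulrBl mul1r; apply: has_csum_unique (binseriesP mu z1).
apply: has_csum_eq (has_csumB h1 h2) => -[|n].
  by rewrite mulr0 subr0 !bincoef0.
rewrite bincoefS exprS; ring.
Qed.

Lemma sub1_neq0 z : normc z < 1 -> 1 - z != 0.
Proof.
by rewrite subr_eq0; apply: contraTneq => <-; rewrite normc1 ltxx.
Qed.

Lemma binseriesD mu n z : normc z < 1 ->
  binseries (mu + n%:R) z = binseries mu z * (1 - z) ^- n.
Proof.
move=> z1; have nz := sub1_neq0 z1.
elim: n => [|n IH]; first by rewrite addr0 expr0 invr1 mulr1.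
rewrite -natr1 addrA exprSr invfM mulrA -IH -(binseriesS (mu + n%:R) z1).
by rewrite mulrC mulKf.
Qed.

Lemma sum_le_support (f : nat -> R) j m : (forall n, 0 <= f n) ->
  (forall n, (j <= n)%N -> f n = 0) -> \sum_(n < m) f n <= \sum_(n < j) f n.
Proof.
move=> f0 fj; have [mj|jm] := leqP m j.
  rewrite -(subnKC mj) big_split_ord /= lerDl sumr_ge0 //.
rewrite -(subnKC (ltnW jm)) big_split_ord /= [X in _ + X]big1 ?addr0 // => i _.
by rewrite fj // leq_addr.
Qed.

(** * Recentring power series, and local analyticity *)

Section recentering.
Variables (a : nat -> R[i]) (z : R[i]) (r M : R).
Hypothesis r0 : 0 <= r.
Hypothesis aM : bounded_at a (normc z + r) M.

(** The double array of the expansions of a_i (z + h)^i. For n > i the truncated [i - n] is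
    harmless, the binomial coefficient being 0. *)
Let T (h : R[i]) i n := a i * 'C(i, n)%:R * z ^+ (i - n) * h ^+ n.

Let T_bound h i : normc h <= r ->
  abs_bounded (T h i) (normc (a i) * (normc z + r) ^+ i).
Proof.
move=> hr m.
have E n : normc (T h i n) =
    normc (a i) * (normc z ^+ (i - n) * normc h ^+ n *+ 'C(i, n)).
  by rewrite !normcM !normcX normc_nat -mulr_natr; ring.
have h0 := normc_ge0 h; have z0 := normc_ge0 z.
apply: (le_trans (@sum_le_support (fun n => normc (T h i n)) i.+1 m _ _)).
- by move=> n; exact: normc_ge0.
- by move=> n ni; rewrite /T bin_small // mulr0 !mul0r normc0.
under eq_bigr do rewrite E.
rewrite -mulr_sumr -exprDn ler_wpM2l ?normc_ge0 // lerXn2r ?nnegrE ?addr_ge0 //.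
by rewrite lerD2l.
Qed.

(** Row i has absolute sum at most |a_i| (|z| + r)^i, which is summable by [aM]; hence rows and
    columns may be exchanged. *)
Lemma recenter_has_csum h l c : normc h <= r ->
  has_csum (fun n => a n * (z + h) ^+ n) l ->
  (forall n, has_csum (fun i => a i * 'C(i, n)%:R * z ^+ (i - n) * h ^+ n) (c n)) ->
  has_csum c l.
Proof.
move=> hr hl hc.
apply: (@csum_exchange _ (T h) _ _ _ c l (fun i => @T_bound h i hr) aM _ hc hl) => i.
have -> : a i * (z + h) ^+ i = \sum_(n < i.+1) T h i n.
  rewrite exprDn mulr_sumr; apply: eq_bigr => n _.
  by rewrite /T -mulr_natr; ring.
by apply: has_csum_finite => n ni; rewrite /T bin_small // mulr0 !mul0r.
Qed.

Lemma recenter_coef n : 0 < r ->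
  has_csum (fun i => a i * 'C(i, n)%:R * z ^+ (i - n))
    (csum (fun i => a i * 'C(i, n)%:R * z ^+ (i - n))).
Proof.
(* The array is taken at h = r; dividing its n-th column by r^n bounds the series of the new
   coefficient. *)
move=> rgt0; have rr : normc r%:C <= r by rewrite normc_real ger0_norm.
apply: (@abs_bounded_has_csum _ _ (M / r ^+ n)) => m.
rewrite ler_pdivlMr ?exprn_gt0 //.
have := abs_bounded_column n (fun i => @T_bound r%:C i rr) aM m.
congr (_ <= _); rewrite mulr_suml; apply: eq_bigr => i _.
by rewrite /T [LHS]normcM normcX normc_real ger0_norm.
Qed.

End recentering.

Definition analytic_at (f : R[i] -> R[i]) z := exists2 r : R, 0 < r &
  exists c, forall h, normc h < r -> has_csum (fun n => c n * h ^+ n) (f (z + h)).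

Lemma analytic_at_pseries a (r C : R) z : (forall n, normc (a n) * r ^+ n <= C) ->
  normc z < r -> analytic_at (fun w => csum (fun n => a n * w ^+ n)) z.
Proof.
move=> aC zr; pose e := (r - normc z) / 2.
have e0 : 0 < e by rewrite divr_gt0 // subr_gt0.
have z0 := normc_ge0 z.
have X : 0 <= normc z + e < r by rewrite /e; lra.
have aM := geometric_abs_bounded X aC.
exists e => //; exists (fun n => csum (fun i => a i * 'C(i, n)%:R * z ^+ (i - n))).
move=> h /ltW he; apply: (recenter_has_csum (ltW e0) aM he).
  apply: abs_bounded_has_csum (bounded_at_abs aM _).
  by rewrite (le_trans (le_normcD _ _)) // lerD2l.
move=> n; have := has_csumZ (h ^+ n) (recenter_coef (ltW e0) aM n e0).
by rewrite mulrC; apply: has_csum_eq => i; rewrite mulrC.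
Qed.

(** Taylor coefficients at z, read off (1 - z - h)^(-mu) = (1 - z)^(-mu) (1 - h / (1 - z))^(-mu). *)
Definition binseries_coef mu z n := binseries mu z * bincoef mu n * (1 - z) ^- n.

(** By [bincoefM], the n-th column is (mu)_n / n! h^n times the binomial series of exponent mu + n
    at z, shifted by n places because the entries with i < n vanish. *)
Lemma binseries_recenter mu z h : normc z + normc h < 1 ->
  has_csum (fun n => binseries_coef mu z n * h ^+ n) (binseries mu (z + h)).
Proof.
move=> zh; have z0 := normc_ge0 z; have h0 := normc_ge0 h.
have z1 : normc z < 1 by rewrite (le_lt_trans _ zh) // lerDl.
have zh1 : normc (z + h) < 1 by rewrite (le_lt_trans (le_normcD _ _)).
have [j muj] := normc_le_nat mu.
have zh01 : 0 <= normc z + normc h < 1 by rewrite addr_ge0.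
apply: (recenter_has_csum h0 (bincoef_bounded muj zh01) (lexx _) (binseriesP mu zh1)).
move=> n; rewrite /binseries_coef.
have := has_csumZ (bincoef mu n * h ^+ n) (binseriesP (mu + n%:R) z1).
rewrite binseriesD // => /(has_csum_addn n).
rewrite -[binseries mu z * _ * _]mulrA mulrC.
congr has_csum; last by ring.
apply/funext => i; case: leqP => [ni|ni]; last first.
  by rewrite bin_small // mulr0 !mul0r.
by have := bincoefM mu n (i - n); rewrite subnKC // => ->; ring.
Qed.

End binomial_series.

(** * The identity theorem along a segment *)

Section identity_theorem.
Context {R : realType}.
Implicit Types (z h t : R[i]) (c : nat -> R[i]) (f g : R[i] -> R[i]).

(** Isolated zeros: at the first nonzero coefficient c_n, dividing by h^n leaves |c_n| <= |h| D with
    D bounding the remaining series, which is impossible once |h| (D + 1) < |c_n|. *)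
Lemma pseries_eq0 c :
  (forall e : R, 0 < e -> exists h, 0 < normc h < e /\
     has_csum (fun n => c n * h ^+ n) 0) -> forall n, c n = 0.
Proof.
move=> H; have [h0 [/andP[r0 _] /has_csum_bounded[C _ cC]]] := H 1 ltr01.
set r := normc h0 in r0; have {}cC n : normc (c n) * r ^+ n <= C.
  by rewrite -normcX -normcM.
elim/ltn_ind => n IH; apply/eqP; apply: contraT; rewrite -normc_gt0 => cn0.
have r2 : 0 <= r / 2 < r by lra.
have [D DP] : exists D, forall m,
    \sum_(i < m) normc (c (n.+1 + i)%N) * (r / 2) ^+ i <= D.
  exists (C / r ^+ n.+1 * r / (r - r / 2)).
  apply: (@geometric_abs_bounded _ (fun i => c (n.+1 + i)%N) (C / r ^+ n.+1) _ _ r2).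
  by move=> m; rewrite ler_pdivlMr ?exprn_gt0 // -mulrA -exprD addnC.
have D0 : 0 <= D by have := DP 0%N; rewrite big_ord0.
have e0 : 0 < Num.min (r / 2) (normc (c n) / (D + 1)).
  by rewrite lt_min; apply/andP; split; apply: divr_gt0; lra.
have [h [/andP[h0' hm] hc]] := H _ e0.
move: hm; rewrite lt_min => /andP[hr]; rewrite ltr_pdivlMr; last by lra.
have hn0 : h != 0 by rewrite -normc_gt0.
have := has_csum_drop n hc; rewrite big1 ?subr0 => [|i _]; last first.
  by rewrite IH ?mul0r.
move=> /(has_csumZ (h ^- n)) /(has_csum_drop 1).
rewrite big_ord1 mulr0 sub0r addn0 mulrCA mulVf ?expf_neq0 // mulr1 => hs.
suff : normc (c n) <= normc h * D.
  by move=> h1 h2; have := normc_ge0 h; nra.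
rewrite -normcN; apply: has_csum_le hs _ => m.
apply: (@le_trans _ _ (normc h * \sum_(i < m) normc (c (n.+1 + i)%N) * (r / 2) ^+ i)); last first.
  by rewrite ler_wpM2l ?normc_ge0.
rewrite mulr_sumr ler_sum // => i _.
have hn := expf_neq0 n hn0.
have -> : h ^- n * (c (n + (1 + i))%N * h ^+ (n + (1 + i))) =
    h * (c (n.+1 + i)%N * h ^+ i).
  by rewrite addnA addn1 exprD exprS; field.
rewrite !normcM normcX ler_wpM2l ?normc_ge0 // ler_wpM2l ?normc_ge0 //.
by rewrite lerXn2r ?nnegrE ?normc_ge0 ?(ltW hr) //; lra.
Qed.

Lemma analytic_atB f g z :
  analytic_at f z -> analytic_at g z -> analytic_at (fun w => f w - g w) z.
Proof.
move=> [r r0 [c cP]] [r' r'0 [c' c'P]].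
exists (Num.min r r'); first by rewrite lt_min r0.
exists (fun n => c n - c' n) => h; rewrite lt_min => /andP[/cP h1 /c'P h2].
by apply: has_csum_eq (has_csumB h1 h2) => n; rewrite mulrBl.
Qed.

(** Connectedness: let S be the supremum of the parameters up to which f vanishes. Zeros accumulate
    at S t, so the expansion there is zero and f vanishes beyond S, a contradiction. *)
Lemma analytic_segment_eq0 f t : t != 0 ->
  (forall s : R, 0 <= s < 1 -> analytic_at f (s%:C * t)) ->
  (exists2 r : R, 0 < r & forall h, normc h < r -> f h = 0) ->
  forall s : R, 0 <= s < 1 -> f (s%:C * t) = 0.
Proof.
move=> t0 fan [r r0 fr] s0 /andP[s00 s01]; apply/eqP; apply: contraT => fs0.
have nt0 : 0 < normc t by rewrite normc_gt0.
(* The strict bound s' < s puts 0 in [A] vacuously; a nonzero value at [s0] bounds [A] by [s0]. *)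
pose A := [set s : R | 0 <= s /\ forall s' : R, 0 <= s' < s -> f (s'%:C * t) = 0].
have A0 : A 0 by split=> // s' /andP[h1 /(le_lt_trans h1)]; rewrite ltxx.
have As : ubound A s0.
  move=> a [a0 aP]; rewrite leNgt; apply/negP => s0a.
  by move: fs0; rewrite aP ?eqxx // s00.
have Asup : has_sup A by split; [exists 0|exists s0].
pose S := sup A.
have S0 : 0 <= S by exact: ub_le_sup (ex_intro _ _ As) _ A0.
have Ss : S <= s0 by exact: ge_sup (ex_intro _ _ A0) As.
have fS (s' : R) : 0 <= s' < S -> f (s'%:C * t) = 0.
  move=> /andP[s'0 s'S]; have e0 : 0 < S - s' by rewrite subr_gt0.
  have [a [_ aP] ha] := sup_adherent e0 Asup.
  by apply: aP; rewrite s'0 /= ; move: ha; rewrite -/S; lra.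
have [|r' r'0 [c cP]] := fan S; first by rewrite S0; lra.
have c0 : forall n, c n = 0.
  apply: pseries_eq0 => e e0.
  (* At S = 0 the small zeros come from the disc around the origin, otherwise from the points just
     before S. *)
  have [SE|Sn0] := eqVneq S 0.
    pose y := Num.min r (Num.min e r') / (2 * normc t).
    have m0 : 0 < Num.min r (Num.min e r') by rewrite !lt_min r0 e0 r'0.
    have y0 : 0 < y by rewrite divr_gt0 // mulr_gt0.
    have yt : normc (y%:C * t) < Num.min r (Num.min e r').
      rewrite normcM normc_real gtr0_norm // /y; set m := Num.min _ _ in m0 *.
      by have -> : m / (2 * normc t) * normc t = m / 2; [field; rewrite gt_eqF|lra].
    move: (yt); rewrite !lt_min => /and3P[y1 y2 y3].
    exists (y%:C * t); split.
      by rewrite y2 andbT normcM normc_real mulr_gt0 // normr_gt0 gt_eqF.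
    by have := cP _ y3; rewrite SE mul0r add0r fr.
  have Sgt0 : 0 < S by rewrite lt_neqAle eq_sym Sn0.
  pose y := Num.min (S * normc t) (Num.min e r') / (2 * normc t).
  have m0 : 0 < Num.min (S * normc t) (Num.min e r').
    by rewrite !lt_min mulr_gt0 // e0 r'0.
  have y0 : 0 < y by rewrite divr_gt0 // mulr_gt0.
  have yt : normc (- (y%:C * t)) < Num.min (S * normc t) (Num.min e r').
    rewrite normcN normcM normc_real gtr0_norm // /y; set m := Num.min _ _ in m0 *.
    by have -> : m / (2 * normc t) * normc t = m / 2; [field; rewrite gt_eqF|lra].
  move: (yt); rewrite !lt_min => /and3P[y1 y2 y3].
  exists (- (y%:C * t)); split.
    by rewrite y2 andbT normcN normcM normc_real mulr_gt0 // normr_gt0 gt_eqF.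
  have := cP _ y3; rewrite -mulrBl -rmorphB fS //.
  move: y1; rewrite normcN normcM normc_real gtr0_norm // ltr_pM2r // => yS.
  by apply/andP; split; lra.
have fz h : normc h < r' -> f (S%:C * t + h) = 0.
  move=> /cP hs; apply: has_csum_unique hs _.
  by apply: has_csum_eq has_csum0 => n; rewrite c0 mul0r.
(* Advancing the parameter by [y] moves the point by r' / 2, within the disc where f is now zero. *)
pose y := r' / (2 * normc t).
have y0 : 0 < y by rewrite divr_gt0 // mulr_gt0.
suff : A (S + y).
  by move=> /(ub_le_sup (ex_intro _ _ As)); rewrite -/S gerDl leNgt y0.
split=> [|s' /andP[s'0 s'y]]; first by lra.
have [s'S|Ss'] := ltP s' S; first by rewrite fS // s'0.
rewrite -(subrK S s') addrC rmorphD mulrDl fz // normcM normc_real.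
rewrite ger0_norm ?subr_ge0 //.
have : y * normc t = r' / 2 by rewrite /y; field; rewrite gt_eqF.
have : (s' - S) * normc t <= y * normc t by rewrite ler_pM2r //; lra.
lra.
Qed.

End identity_theorem.

(** * The binomial transform of a power series and its local expansions *)

Section transform.
Context {R : realType}.
Implicit Types (z h t mu : R[i]) (a c : nat -> R[i]).

(* Multiplication by [z + X] of the power series [a] in [X]. *)
Definition mul_addX z a n := z * a n + (if n is n'.+1 then a n' else 0).

Lemma mul_addX_has_csum z h a l : has_csum (fun n => a n * h ^+ n) l ->
  has_csum (fun n => mul_addX z a n * h ^+ n) ((z + h) * l).
Proof.
move=> al; rewrite mulrDl.
apply: has_csum_eq (has_csumD (has_csumZ z al) (has_csumZ h (has_csum_shift al))).
by move=> [|n]; rewrite /mul_addX ?exprS; ring.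
Qed.

Lemma mul_addX_bounded z a (r M : R) : 0 <= r -> bounded_at a r M ->
  bounded_at (mul_addX z a) r ((normc z + r) * M).
Proof.
move=> r0 aM m.
apply: (@le_trans _ _ (normc z * (\sum_(n < m) normc (a n) * r ^+ n) +
    r * (\sum_(n < m.-1) normc (a n) * r ^+ n))); last first.
  by rewrite mulrDl lerD // ler_wpM2l ?normc_ge0.
have -> : r * (\sum_(n < m.-1) normc (a n) * r ^+ n) =
    \sum_(n < m) (if nat_of_ord n is n'.+1 then r * (normc (a n') * r ^+ n') else 0).
  case: m => [|m]; first by rewrite !big_ord0 mulr0.
  by rewrite big_ord_recl add0r mulr_sumr.
rewrite mulr_sumr -big_split ler_sum //= => -[n _] _ /=.
rewrite /mul_addX mulrA -normcM; case: n => [|n]; first by rewrite !addr0.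
have -> : r * (normc (a n) * r ^+ n) = normc (a n) * r ^+ n.+1.
  by rewrite exprS; ring.
by rewrite -mulrDl ler_wpM2r ?le_normcD // exprn_ge0.
Qed.

Lemma iter_mul_addX_has_csum z h a l j : has_csum (fun n => a n * h ^+ n) l ->
  has_csum (fun n => iter j (mul_addX z) a n * h ^+ n) ((z + h) ^+ j * l).
Proof.
move=> al; elim: j => [|j IH]; first by rewrite mul1r.
by rewrite exprS -mulrA; exact: mul_addX_has_csum.
Qed.

Lemma iter_mul_addX_bounded z a (r M : R) j : 0 <= r -> bounded_at a r M ->
  bounded_at (iter j (mul_addX z) a) r ((normc z + r) ^+ j * M).
Proof.
move=> r0 aM; elim: j => [|j IH]; first by rewrite mul1r.
by rewrite exprS -mulrA; exact: mul_addX_bounded.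
Qed.

Lemma iter_mul_addX0 a j n :
  iter j (mul_addX 0) a n = if (j <= n)%N then a (n - j)%N else 0.
Proof.
elim: j n => [|j IH] n; first by rewrite subn0.
by rewrite iterS /mul_addX mul0r add0r; case: n => [//|n]; rewrite IH.
Qed.

Lemma lt_normc_sub1 z (r : R) : normc z + r < 1 -> r < normc (1 - z).
Proof.
move=> zr; have := normcD3 1 z 0; rewrite !subr0 normc1; lra.
Qed.

Variables (lam : R[i]) (d k : nat) (B : nat -> R[i]).
Hypothesis d_gt0 : (0 < d)%N.

(* Formally, both [binseries lam z * \sum_m B m * (z ^+ d / (1 - z) ^+ k) ^+ m] and
   the power series in [z] with coefficients [transform_coef]. *)
Definition transform z := csum (fun m => B m * z ^+ (d * m) * binseries (lam + (k * m)%:R) z).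

Definition transform_coef n : R[i] := \sum_(m < n.+1)
  B m * (if (d * m <= n)%N then bincoef (lam + (k * m)%:R) (n - d * m) else 0).

Lemma transform_term z m : normc z < 1 ->
  B m * z ^+ (d * m) * binseries (lam + (k * m)%:R) z =
  binseries lam z * (B m * (z ^+ d / (1 - z) ^+ k) ^+ m).
Proof.
move=> z1; rewrite binseriesD // expr_div_n -!exprM; ring.
Qed.

(* Coefficient of [h ^+ n] in the [m]-th term of [transform (z + h)]. *)
Let E z m n := B m * iter (d * m) (mul_addX z) (binseries_coef (lam + (k * m)%:R) z) n.

(** Put q = r / |1 - z|. Raising the exponent by k m multiplies the value at z by (1 - z)^(-k m) and
    the majorant by (1 - q)^(-k m); together these give the only factor depending on m, a power of
    |1 - z| - r. *)
Lemma binseries_coef_bounded z (r : R) j m : normc lam <= j%:R ->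
  0 <= r -> normc z < 1 -> r < normc (1 - z) ->
  bounded_at (binseries_coef (lam + (k * m)%:R) z) r
    (normc (binseries lam z) * (1 - r / normc (1 - z)) ^- j *
     (normc (1 - z) - r) ^- (k * m)).
Proof.
move=> lamj r0 z1 rz n; have nz := sub1_neq0 z1.
have rz0 : 0 < normc (1 - z) by rewrite normc_gt0.
pose q := r / normc (1 - z).
have q01 : 0 <= q < 1 by rewrite /q divr_ge0 ?(ltW rz0) //= ltr_pdivrMr ?mul1r.
have lamkj : normc (lam + (k * m)%:R) <= (j + k * m)%:R.
  by rewrite (le_trans (le_normcD _ _)) // normc_nat natrD lerD2r.
have := bincoef_bounded lamkj q01 n.
set b := normc (binseries lam z * (1 - z) ^- (k * m)).
have b0 : 0 <= b by exact: normc_ge0.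
move=> /(ler_wpM2l b0).
have -> : b * (1 - q) ^- (j + k * m) = normc (binseries lam z) *
    (1 - q) ^- j * (normc (1 - z) - r) ^- (k * m).
  have -> : normc (1 - z) - r = normc (1 - z) * (1 - q).
    by rewrite /q; field; rewrite gt_eqF.
  rewrite /b normcM normcV normcX exprD exprMn !invfM; ring.
congr (_ <= _); rewrite mulr_sumr; apply: eq_bigr => i _.
have -> : normc (binseries_coef (lam + (k * m)%:R) z i) =
    b * normc (bincoef (lam + (k * m)%:R) i) * normc (1 - z) ^- i.
  rewrite /binseries_coef binseriesD // normcM [in LHS]normcM -/b.
  by rewrite -normcX -normcV.
by rewrite /q expr_div_n; ring.
Qed.

(** For |h| <= r, the m-th term is a power series in h with absolute sum at most D |B_m| X^m, where
    X is the ratio in the hypothesis; X < Y makes these bounds summable and allows the exchange. *)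
Lemma transform_recenter z (r Y C : R) : 0 < r -> normc z + r < 1 ->
  (normc z + r) ^+ d / (normc (1 - z) - r) ^+ k < Y ->
  (forall m, normc (B m) * Y ^+ m <= C) ->
  forall h, normc h <= r ->
  has_csum (fun n => csum (fun m => E z m n) * h ^+ n) (transform (z + h)).
Proof.
move=> r0 zr XY BC h hr; have z0 := normc_ge0 z; have h0 := normc_ge0 h.
have z1 : normc z < 1 by lra.
have zh1 : normc z + normc h < 1 by lra.
have rz : r < normc (1 - z) by exact: lt_normc_sub1.
set X := (X in X < Y) in XY.
have X0 : 0 <= X by rewrite divr_ge0 // exprn_ge0 //; lra.
have [j lamj] := normc_le_nat lam.
pose D := normc (binseries lam z) * (1 - r / normc (1 - z)) ^- j.
have rz0 : 0 < normc (1 - z) by lra.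
have D0 : 0 <= D.
  rewrite mulr_ge0 ?normc_ge0 // invr_ge0 exprn_ge0 // subr_ge0.
  by rewrite ler_pdivrMr // mul1r ltW.
pose T m n := E z m n * h ^+ n.
have EB m : bounded_at (E z m) r (D * (normc (B m) * X ^+ m)) => [n|].
  have := iter_mul_addX_bounded z (d * m) (ltW r0)
    (binseries_coef_bounded m lamj (ltW r0) z1 rz) n.
  move=> /(ler_wpM2l (normc_ge0 (B m))); rewrite mulr_sumr.
  have -> : normc (B m) * ((normc z + r) ^+ (d * m) *
     (normc (binseries lam z) * (1 - r / normc (1 - z)) ^- j *
      (normc (1 - z) - r) ^- (k * m))) = D * (normc (B m) * X ^+ m).
    rewrite /X /D expr_div_n -!exprM; ring.
  congr (_ <= _); apply: eq_bigr => i _; rewrite /E normcM; ring.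
have XY' : 0 <= X < Y by rewrite X0.
have BM m : \sum_(i < m) D * (normc (B i) * X ^+ i) <= D * (C * Y / (Y - X)).
  by rewrite -mulr_sumr ler_wpM2l // geometric_abs_bounded.
have TB m : abs_bounded (T m) (D * (normc (B m) * X ^+ m)).
  exact: bounded_at_abs (EB m) hr.
have rows m : has_csum (T m)
    (B m * (z + h) ^+ (d * m) * binseries (lam + (k * m)%:R) (z + h)).
  have := has_csumZ (B m) (iter_mul_addX_has_csum z (d * m)
    (binseries_recenter (lam + (k * m)%:R) zh1)).
  by rewrite mulrA; apply: has_csum_eq => n; rewrite mulrA.
apply: (csum_exchange TB BM rows).
  move=> n; rewrite mulrC.
  have colb : abs_bounded (fun m => E z m n) (D * (C * Y / (Y - X)) / r ^+ n).
    move=> m; rewrite ler_pdivlMr ?exprn_gt0 //.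
    have rr : normc r%:C <= r by rewrite normc_real gtr0_norm.
    have := abs_bounded_column n (fun i => bounded_at_abs (EB i) rr) BM m.
    congr (_ <= _); rewrite mulr_suml; apply: eq_bigr => i _.
    by rewrite normcM normcX normc_real gtr0_norm.
  have := has_csumZ (h ^+ n) (abs_bounded_has_csum colb).
  by apply: has_csum_eq => m; rewrite mulrC.
apply: (@abs_bounded_has_csum _ _ (D * (C * Y / (Y - X)))) => m.
rewrite (le_trans _ (BM m)) // ler_sum // => i _.
exact: has_csum_le (rows i) (TB i).
Qed.

Lemma transform_recenter0 n : csum (fun m => E 0 m n) = transform_coef n.
Proof.
apply: has_csum_csum.
have F m : E 0 m n = B m * (if (d * m <= n)%N then bincoef (lam + (k * m)%:R) (n - d * m) else 0).
  rewrite /E iter_mul_addX0 /binseries_coef binseries0 subr0 mul1r.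
  by case: ifP => // _; rewrite expr1n invr1 mulr1.
rewrite /transform_coef (eq_bigr (fun m : 'I_n.+1 => E 0 m n)) => [|m _]; last by rewrite F.
apply: has_csum_finite => m nm; rewrite F leqNgt (leq_trans nm) ?mulr0 //.
by rewrite leq_pmull.
Qed.

(** Continuity as r decreases to 0: the ratio tends to |z^d / (1 - z)^k|, which lies strictly below
    Y. *)
Lemma exists_radius z (Y : R) : normc z < 1 ->
  normc (z ^+ d / (1 - z) ^+ k) < Y ->
  exists2 r : R, 0 < r & normc z + r < 1 /\
    (normc z + r) ^+ d / (normc (1 - z) - r) ^+ k < Y.
Proof.
move=> z1; rewrite normcM normcV !normcX => zY.
have nz0 : normc (1 - z) != 0 by rewrite gt_eqF // normc_gt0 sub1_neq0.
pose f (r : R) := (normc z + r) ^+ d / (normc (1 - z) - r) ^+ k.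
have cf : f r @[r --> 0^'+] --> normc z ^+ d / normc (1 - z) ^+ k.
  have -> : normc z ^+ d / normc (1 - z) ^+ k = f 0 by rewrite /f addr0 subr0.
  have cX (g : R -> R) n : g r @[r --> 0] --> g 0 -> g r ^+ n @[r --> 0] --> g 0 ^+ n.
    move=> gc; elim: n => [|n IH]; first exact: cvg_cst.
    by rewrite exprS; under eq_fun do rewrite exprS; exact: cvgM.
  apply: cvg_at_right_filter; apply: cvgM.
    by apply: (cX (fun r => normc z + r)); apply: cvgD; [exact: cvg_cst|exact: cvg_id].
  apply: cvgV; first by rewrite subr0 expf_neq0.
  by apply: (cX (fun r => normc (1 - z) - r)); apply: cvgB; [exact: cvg_cst|exact: cvg_id].
have [r [[r0 rY] rz]] : exists r, (0 < r /\ f r < Y) /\ r < 1 - normc z.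
  apply: (@filter_ex _ (0 : R)^'+); apply: filterI; first apply: filterI.
  - exact: nbhs_right_gt.
  - exact: (cvgr_lt _ cf).
  - by apply: nbhs_right_lt; rewrite subr_gt0.
exists r => //; split=> //; lra.
Qed.

Lemma transform_analytic z (Y C : R) : normc z < 1 ->
  normc (z ^+ d / (1 - z) ^+ k) < Y -> (forall m, normc (B m) * Y ^+ m <= C) ->
  analytic_at transform z.
Proof.
move=> z1 zY BC; have [r r0 [zr XY]] := exists_radius z1 zY.
exists r => //; exists (fun n => csum (fun m => E z m n)) => h /ltW hr.
exact: transform_recenter XY BC _ hr.
Qed.

(** At the origin z^d / (1 - z)^k vanishes since d > 0, so any positive Y leaves room for a
    radius. *)
Lemma transform_series0 (Y C : R) : 0 < Y -> (forall m, normc (B m) * Y ^+ m <= C) ->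
  exists2 r : R, 0 < r & forall h, normc h < r ->
    has_csum (fun n => transform_coef n * h ^+ n) (transform h).
Proof.
move=> Y0 BC; have n01 : normc (0 : R[i]) < 1 by rewrite normc0.
have [|r r0 [zr XY]] := @exists_radius 0 Y n01.
  by rewrite expr0n gtn_eqF // mul0r normc0.
exists r => // h /ltW hr; have := transform_recenter r0 zr XY BC hr.
by rewrite add0r; apply: has_csum_eq => n; rewrite transform_recenter0.
Qed.

(** Bounded terms at t give radius |t| to the left series and serve as the bound with Y = |y(t)| for
    the right one; both sides are then analytic on the segment and agree near 0. *)
Lemma transform_segment t (C C' : R) : t != 0 -> normc t < 1 ->
  (forall n, normc (transform_coef n * t ^+ n) <= C) ->
  (forall m, normc (B m * (t ^+ d / (1 - t) ^+ k) ^+ m) <= C') ->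
  forall s : R, 0 <= s < 1 ->
  (forall s : R, 0 <= s < 1 ->
    normc ((s%:C * t) ^+ d / (1 - s%:C * t) ^+ k) < normc (t ^+ d / (1 - t) ^+ k)) ->
  csum (fun n => transform_coef n * (s%:C * t) ^+ n) = transform (s%:C * t).
Proof.
move=> t0 t1 gC BC s s01 yP; apply/eqP; rewrite -subr_eq0; apply/eqP.
pose G w := csum (fun n => transform_coef n * w ^+ n).
have nt0 : 0 < normc t by rewrite normc_gt0.
have gC' n : normc (transform_coef n) * normc t ^+ n <= C by rewrite -normcX -normcM.
set Y := normc (t ^+ d / (1 - t) ^+ k).
have BC' m : normc (B m) * Y ^+ m <= C' by rewrite -normcX -normcM.
have Y0 : 0 < Y.
  by rewrite normc_gt0 mulf_neq0 ?invr_eq0 ?expf_neq0 // sub1_neq0.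
have seg (s' : R) : 0 <= s' < 1 -> normc (s'%:C * t) < normc t.
  move=> /andP[s'0 s'1]; rewrite normcM normc_real ger0_norm //.
  by rewrite -[ltRHS]mul1r ltr_pM2r.
apply: (@analytic_segment_eq0 _ (fun w => G w - transform w)) => // [s' s'01|].
  apply: analytic_atB; first exact: analytic_at_pseries gC' (seg _ s'01).
  apply: transform_analytic (yP _ s'01) BC'.
  exact: lt_trans (seg _ s'01) t1.
have [r' r'0 r'P] := transform_series0 Y0 BC'.
by exists r' => // h /r'P /has_csum_csum; rewrite -/(G h) => ->; rewrite subrr.
Qed.

End transform.

(** * Abel's theorem in a Stolz angle *)

Section abel_stolz.
Context {R : realType}.
Implicit Types (z h t mu q : R[i]) (a : nat -> R[i]).

Lemma sum_geometric_le (x : R) m : 0 <= x < 1 -> \sum_(i < m) x ^+ i <= (1 - x)^-1.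
Proof.
move=> /andP[x0 x1]; rewrite -[leRHS]mul1r ler_pdivlMr ?subr_gt0 //.
by rewrite mulrC -opprB mulNr -subrX1 opprB gerBl exprn_ge0.
Qed.

(** Summation by parts against the remainders T_n = sum_(i<n) a_i - l leaves T_(m+1) w^m + (1 - w)
    sum_(n<m) T_(n+1) w^n. The factor 1 - w kills the finitely many large remainders; on the others
    the Stolz condition bounds |1 - w| / (1 - |w|) by K. *)
Lemma abel_stolz a l (q : nat -> R[i]) (K : R) (L : nat -> R[i]) :
  has_csum a l -> ccvg q 1 ->
  (forall j, normc (q j) < 1 /\ normc (1 - q j) <= K * (1 - normc (q j))) ->
  (forall j, has_csum (fun n => a n * q j ^+ n) (L j)) -> ccvg L l.
Proof.
move=> al q1 qK qL e e0.
have K0 : 0 <= K.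
  have [h1 h2] := qK 0%N; rewrite -(@pmulr_lge0 _ (1 - normc (q 0%N))) ?subr_gt0 //.
  by rewrite (le_trans _ h2) ?normc_ge0.
(* The error consists of one [K * e'] and three contributions of at most [e'], with one [e'] to
   spare. *)
pose e' := e / (K + 4).
have e'0 : 0 < e' by rewrite divr_gt0 //; lra.
pose T n := \sum_(i < n) a i - l.
have [n0 n0P] := al _ e'0.
pose A := \sum_(n < n0) normc (T n.+1).
have A0 : 0 <= A by apply: sumr_ge0 => i _; exact: normc_ge0.
have [j0 j0P] := q1 (e' / (A + 1)) (divr_gt0 e'0 (ltr_wpDl A0 ltr01)).
exists j0 => j /j0P; rewrite normcB ltr_pdivlMr; last by lra.
have [qj1 qjK] := qK j; move: (q j) (L j) (qL j) qj1 qjK => w Lw hL w1 wK wA.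
have w0 := normc_ge0 w; have w10 := normc_ge0 (1 - w).
have E m : \sum_(n < m.+1) a n * w ^+ n - l =
    T m.+1 * w ^+ m + (1 - w) * \sum_(n < m) T n.+1 * w ^+ n.
  elim: m => [|m IH]; first by rewrite /T !big_ord1 big_ord0 expr0; ring.
  have -> : \sum_(n < m.+2) a n * w ^+ n - l =
      (\sum_(n < m.+1) a n * w ^+ n - l) + a m.+1 * w ^+ m.+1.
    by rewrite big_ord_recr /=; ring.
  rewrite IH [in RHS]big_ord_recr /=.
  have -> : a m.+1 = T m.+2 - T m.+1 by rewrite /T [in RHS]big_ord_recr /=; ring.
  rewrite exprS; ring.
have TP n : (n0 <= n.+1)%N -> normc (T n.+1) <= e' by move=> /n0P/ltW.
have bound m : (n0 <= m)%N -> normc (\sum_(n < m.+1) a n * w ^+ n - l) <=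
    e' + normc (1 - w) * A + e' * K.
  move=> nm; rewrite E -addrA (le_trans (le_normcD _ _)) // lerD //.
    rewrite normcM normcX -[leRHS]mulr1 ler_pM ?normc_ge0 ?exprn_ge0 //.
      by rewrite TP // (leq_trans nm).
    by rewrite exprn_ile1 // ltW.
  have S : normc (\sum_(n < m) T n.+1 * w ^+ n) <= A + e' * (1 - normc w)^-1.
    rewrite -(subnKC nm) big_split_ord /= (le_trans (le_normcD _ _)) // lerD //.
      rewrite (le_trans (normc_sum _ _ _)) // ler_sum // => i _.
      by rewrite normcM normcX ler_piMr ?normc_ge0 // exprn_ile1 // ltW.
    have w01 : 0 <= normc w < 1 by rewrite w0.
    have := sum_geometric_le (m - n0) w01 => /(ler_wpM2l (ltW e'0)).
    apply: le_trans; rewrite (le_trans (normc_sum _ _ _)) // mulr_sumr ler_sum // => i _.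
    rewrite normcM normcX ler_pM ?normc_ge0 ?exprn_ge0 //.
      by rewrite TP // -addnS leq_addr.
    by rewrite exprD ler_piMl ?exprn_ge0 // exprn_ile1 // ltW.
  rewrite normcM (le_trans (ler_wpM2l w10 S)) // mulrDr lerD2l.
  rewrite mulrCA ler_wpM2l ?(ltW e'0) // ler_pdivrMr ?subr_gt0 //.
have [m0 /(_ (maxn m0 n0).+1 (leqW (leq_maxl _ _))) h1] := hL _ e'0.
have h2 := bound _ (leq_maxr m0 n0).
have := normcD3 Lw (\sum_(n < (maxn m0 n0).+1) a n * w ^+ n) l.
rewrite normcB in h1; have Ee : e = e' * (K + 4) by rewrite /e'; field; rewrite gt_eqF //; lra.
have : normc (1 - w) * A <= normc (1 - w) * (A + 1) by rewrite ler_wpM2l // lerDl.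
rewrite Ee mulrDr; lra.
Qed.

Lemma normc_sqr (x y : R) : normc (x +i* y) ^+ 2 = x ^+ 2 + y ^+ 2.
Proof. by rewrite /= sqr_sqrtr // addr_ge0 // sqr_ge0. Qed.

(* [koebe_ratio kappa t s] is the quotient of the values at [s * t] and [t] of
   the map z |-> z / (1 - z) ^ kappa, along a path approaching 1 within a Stolz angle. *)
Definition koebe_ratio (kappa : nat) t (s : R) : R[i] :=
  s%:C * ((1 - t) / (1 - s%:C * t)) ^+ kappa.

(** Let q be the ratio. For kappa = 0, q = s. For kappa = 1, 1 - q = (1 - s) / (1 - s t) and |1 - s
    t|^2 - s^2 |1 - t|^2 = (1 - s) (1 + s - 2 s Re t). For kappa = 2, 1 - q = (1 - s) (1 - s t^2) /
    (1 - s t)^2 and |1 - s t|^2 - s |1 - t|^2 = (1 - s) (1 - s |t|^2). Every cofactor is controlled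
    by D = 1 - |t|. *)
Lemma koebe_ratio_stolz (kappa : nat) t : (kappa <= 2)%N -> normc t < 1 ->
  exists K : R, forall s : R, 0 <= s < 1 ->
    normc (1 - koebe_ratio kappa t s) <= K * (1 - s) /\
    1 - s <= K * (1 - normc (koebe_ratio kappa t s)).
Proof.
move=> kappa2 t1; pose D := 1 - normc t.
have D0 : 0 < D by rewrite subr_gt0.
have t0 := normc_ge0 t.
have st1 (s : R) : 0 <= s < 1 -> normc (s%:C * t) <= normc t.
  move=> /andP[s0 s1]; rewrite normcM normc_real ger0_norm //.
  by rewrite ler_piMl // ltW.
have lo (s : R) : 0 <= s < 1 -> D <= normc (1 - s%:C * t).
  move=> /st1 h; have := normcD3 1 (s%:C * t) 0; rewrite !subr0 normc1 /D; lra.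
have hi z : normc z <= normc t -> normc (1 - z) <= 2.
  move=> h; have := le_normcD 1 (- z); rewrite normcN normc1; lra.
case: kappa kappa2 => [|[|[|//]]] _; rewrite /koebe_ratio.
- exists 1 => s /andP[s0 s1]; rewrite expr0 mulr1 !mul1r normc_real ger0_norm //.
  by rewrite -[1]/(1%:C) -rmorphB normc_real ger0_norm // subr_ge0 ltW.
(* The 8 is 4 times 2: |w| + s |1 - t| <= 4 in the difference of squares, and |w| <= 2 in the
   denominator. *)
- exists (8 / D) => s s01; have /andP[s0 s1] := s01.
  have nl := lo s s01; have nh := hi _ (st1 s s01); have n1 := hi t (lexx _).
  set w := 1 - s%:C * t in nl nh *; have w0 : 0 < normc w by lra.
  have wn0 : w != 0 by rewrite -normc_gt0.
  have s1' : normc (1 - s%:C) = 1 - s.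
    by rewrite -[1]/(1%:C) -rmorphB normc_real ger0_norm // subr_ge0 ltW.
  have D1 : D <= 1 by rewrite /D; lra.
  split.
    have -> : 1 - s%:C * ((1 - t) / w) ^+ 1 = (1 - s%:C) / w.
      by rewrite expr1 /w; field.
    rewrite normcM normcV s1' mulrC ler_wpM2r ?subr_ge0 ?(ltW s1) //.
    apply: (@le_trans _ _ D^-1); first by rewrite lef_pV2 ?posrE.
    by apply: ler_peMl; [rewrite invr_ge0; exact: ltW D0|rewrite ler1n].
  rewrite expr1 !normcM normcV normc_real ger0_norm //.
  set u := normc (1 - t) in n1 *; have u0 : 0 <= u by exact: normc_ge0.
  have key : (1 - s) * D <= normc w ^+ 2 - (s * u) ^+ 2.
    have := ler_Re_normc t; rewrite /u /w; case: t @D t1 D0 t0 {st1 lo hi nl nh n1 w w0 wn0 D1 u u0} => x y D t1 D0 t0 xt.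
    rewrite exprMn.
    have -> : 1 - (x +i* y) = (1 - x) +i* (- y) :> R[i].
      by apply/eqP; rewrite eq_complex /= add0r !eqxx.
    have -> : 1 - s%:C * (x +i* y) = (1 - s * x) +i* (- (s * y)) :> R[i].
      by apply/eqP; rewrite eq_complex /= !mul0r subr0 addr0 add0r !eqxx.
    rewrite !normc_sqr.
    have -> : (1 - s * x) ^+ 2 + (- (s * y)) ^+ 2 - s ^+ 2 * ((1 - x) ^+ 2 + (- y) ^+ 2)
      = (1 - s) * (1 + s - 2 * s * x) by ring.
    rewrite ler_wpM2l ?subr_ge0 ?(ltW s1) // /D.
    have {}xt : x <= normc (x +i* y).
      exact: le_trans (ler_norm x) xt.
    move: xt t1 t0; set n := normc _ => xt t1 t0; nra.
  have -> : 8 / D * (1 - s * (u / normc w)) = (8 * (normc w - s * u)) / (D * normc w).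
    by field; rewrite !gt_eqF.
  rewrite ler_pdivlMr ?mulr_gt0 // mulrA.
  have E : normc w ^+ 2 - (s * u) ^+ 2 = (normc w - s * u) * (normc w + s * u) by ring.
  have su : 0 <= s * u <= 2 by apply/andP; split; nra.
  have h1 : 0 <= (1 - s) * D by rewrite mulr_ge0 //; lra.
  have h2 : 0 <= normc w - s * u.
    by rewrite -(@pmulr_lge0 _ (normc w + s * u)) ?(le_trans h1) -?E //; lra.
  have : (normc w - s * u) * (normc w + s * u) <= (normc w - s * u) * 4.
    by rewrite ler_wpM2l //; lra.
  rewrite -E => h3.
  have : (1 - s) * D * normc w <= (1 - s) * D * 2 by rewrite ler_wpM2l.
  lra.
(* Here |w| >= D and |1 - s t^2| <= 2 give the first estimate; |w|^2 <= 4 and D^2 <= D <= 1 - s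
   |t|^2 give the second. *)
exists (4 / D ^+ 2) => s s01; have /andP[s0 s1] := s01.
have nl := lo s s01; have nh := hi _ (st1 s s01); have n1 := hi t (lexx _).
set w := 1 - s%:C * t in nl nh *; have w0 : 0 < normc w by lra.
have wn0 : w != 0 by rewrite -normc_gt0.
have s1' : normc (1 - s%:C) = 1 - s.
  by rewrite -[1]/(1%:C) -rmorphB normc_real ger0_norm // subr_ge0 ltW.
have D1 : D <= 1 by rewrite /D; lra.
have D2 : D ^+ 2 <= D by rewrite expr2 ler_piMl // ltW.
have D20 : 0 < D ^+ 2 by rewrite exprn_gt0.
have DE : normc t = 1 - D by rewrite /D; lra.
split.
  have -> : 1 - s%:C * ((1 - t) / w) ^+ 2 = (1 - s%:C) * ((1 - s%:C * t * t) / w ^+ 2).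
    by rewrite /w; field.
  rewrite !normcM normcV normcX s1' mulrC ler_wpM2r ?subr_ge0 ?(ltW s1) //.
  rewrite ler_pM ?normc_ge0 ?invr_ge0 ?exprn_ge0 ?normc_ge0 //.
    apply: (@le_trans _ _ 2); last by lra.
    apply: hi; rewrite normcM -[leRHS]mul1r ler_wpM2r //.
    by rewrite (le_trans (st1 _ s01)) // ltW.
  rewrite lef_pV2 ?posrE ?exprn_gt0 //.
  by rewrite lerXn2r // nnegrE ltW.
rewrite normcM normcX normcM normcV normc_real ger0_norm //.
have key : normc w ^+ 2 - s * normc (1 - t) ^+ 2 = (1 - s) * (1 - s * normc t ^+ 2).
  rewrite /w; case: t {st1 lo hi t1 t0 nl nh n1 w w0 wn0 D D0 D1 D2 D20 DE} => x y.
  have -> : 1 - (x +i* y) = (1 - x) +i* (- y) :> R[i].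
    by apply/eqP; rewrite eq_complex /= add0r !eqxx.
  have -> : 1 - s%:C * (x +i* y) = (1 - s * x) +i* (- (s * y)) :> R[i].
    by apply/eqP; rewrite eq_complex /= !mul0r subr0 addr0 add0r !eqxx.
  by rewrite !normc_sqr; ring.
have -> : 4 / D ^+ 2 * (1 - s * (normc (1 - t) / normc w) ^+ 2) =
    4 * (normc w ^+ 2 - s * normc (1 - t) ^+ 2) / (D ^+ 2 * normc w ^+ 2).
  by field; rewrite !gt_eqF.
rewrite ler_pdivlMr ?mulr_gt0 ?exprn_gt0 // key [leRHS]mulrCA ler_wpM2l ?subr_ge0 ?(ltW s1) //.
have w2 : normc w ^+ 2 <= 4.
  have -> : 4 = 2 ^+ 2 :> R by rewrite -natrX.
  by rewrite lerXn2r // nnegrE ltW.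
have : D ^+ 2 * normc w ^+ 2 <= D * 4 by rewrite ler_pM ?exprn_ge0 // ltW.
have st2 : s * normc t ^+ 2 <= normc t.
  by rewrite expr2 mulrA ler_piMl // mulr_ile1 // ltW.
lra.
Qed.

Lemma ccvg_le_norm (u : nat -> R[i]) l (b : nat -> R) :
  (forall n, normc (u n - l) <= b n) -> b @ \oo --> (0 : R) -> ccvg u l.
Proof.
move=> ub /cvgrPdist_lt bl e e0; have [n0 _ n0P] := bl e e0.
exists n0 => n /n0P /=; rewrite sub0r normrN => h.
by rewrite (le_lt_trans (ub n)) // (le_lt_trans (ler_norm _)).
Qed.

Definition to_one (j : nat) : R := 1 - j.+1%:R^-1.

Lemma to_one01 j : 0 <= to_one j < 1.
Proof.
rewrite /to_one subr_ge0 invf_le1 ?ltr0n // ler1n /=.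
by rewrite gtrBl invr_gt0 ltr0n.
Qed.

Lemma to_one_cvg (K : R) : (fun j => K * (1 - to_one j)) @ \oo --> (0 : R).
Proof.
rewrite -(mulr0 K); apply: cvgMl_tmp.
rewrite (_ : (fun j => 1 - to_one j) = (@harmonic R)); first exact: cvg_harmonic.
by apply/funext => j; rewrite /to_one /harmonic /=; ring.
Qed.

(** Chaining the two estimates gives the Stolz condition with constant K^2; the second one also
    forces |p s| < 1. *)
Lemma abel_limit a l (K : R) (p : R -> R[i]) (L : R -> R[i]) :
  has_csum a l ->
  (forall s, 0 <= s < 1 ->
    normc (1 - p s) <= K * (1 - s) /\ 1 - s <= K * (1 - normc (p s))) ->
  (forall s, 0 <= s < 1 -> has_csum (fun n => a n * p s ^+ n) (L s)) ->
  ccvg (L \o to_one) l.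
Proof.
move=> al pK pL.
have p0 s : 0 <= s < 1 -> normc (p s) < 1 /\ 0 < K.
  move=> /[dup] s01 /andP[s0 s1]; have [h1 h2] := pK s s01; have := normc_ge0 (1 - p s).
  move=> h0; have s1' : 0 < 1 - s by rewrite subr_gt0.
  have K0 : 0 <= K by rewrite -(@pmulr_lge0 _ (1 - s)) // (le_trans h0).
  have {}K0 : 0 < K.
    by rewrite lt_neqAle K0 andbT; apply: contraTneq h2 => <-; rewrite mul0r -ltNge.
  by split=> //; rewrite -subr_gt0 -(@pmulr_rgt0 _ K) // (lt_le_trans s1').
apply: (@abel_stolz a l (p \o to_one) (K ^+ 2)) => // [|j|j].
- by apply: ccvg_le_norm (to_one_cvg K) => j; rewrite normcB; have [] := pK _ (to_one01 j).
- have [h1 K0] := p0 _ (to_one01 j); split => //=; have [h2 h3] := pK _ (to_one01 j).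
  by rewrite (le_trans h2) // expr2 -mulrA ler_wpM2l // ltW.
- exact: pL (to_one01 j).
Qed.
End abel_stolz.

(** * The binomial series is the principal branch *)

Section principal_branch.
Context {R : realType}.
Implicit Types (z h t mu : R[i]) (c : nat -> R[i]) (f g : R -> R).

(** The difference quotient is within C |e| of l. A quadratic remainder is the form in which power
    series and quadratic polynomials provide their derivative. *)
Lemma is_derive_quadratic f (x l r C : R) : 0 < r ->
  (forall e, `|e| < r -> `|f (x + e) - f x - e * l| <= C * e ^+ 2) ->
  is_derive x 1 f l.
Proof.
move=> r0 fP.
have C0 : 0 <= C.
  have r2 : `|r / 2| < r by rewrite gtr0_norm; lra.
  rewrite -(@pmulr_lge0 _ ((r / 2) ^+ 2)) ?(le_trans _ (fP _ r2)) //.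
  by rewrite exprn_gt0 //; lra.
have lim : h^-1 *: (f (h *: 1 + x) - f x) @[h --> 0^'] --> l.
  apply/cvgrPdist_lt => e e0; near=> h.
  have h0 : h != 0 by near: h; exact: nbhs_dnbhs_neq.
  have hr : `|h| < r by near: h; apply: dnbhs0_lt.
  have he : `|h| < e / (C + 1) by near: h; apply: dnbhs0_lt; rewrite divr_gt0 //; lra.
  have := fP _ hr; rewrite -{1}[h](mulr1 h) [x + _]addrC => hP.
  have -> : l - h^-1 *: (f (h *: 1 + x) - f x) =
      - (h^-1 * (f (h * 1 + x) - f x - h * l)).
    by rewrite /GRing.scale /=; field.
  have nh0 : 0 < `|h| by rewrite normr_gt0.
  rewrite normrN normrM normfV ltr_pdivrMl // (le_lt_trans hP) //.
  rewrite -real_normK ?num_real // expr2 mulrA [ltRHS]mulrC ltr_pM2r //.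
  by move: he; rewrite ltr_pdivlMr; nra.
apply: DeriveDef; first by apply/cvg_ex; exists l.
exact: cvg_lim lim.
Unshelve. all: by end_near. Qed.

Lemma is_derive0_eq f : (forall s : R, 0 <= s <= 1 -> is_derive s 1 f 0) -> f 1 = f 0.
Proof.
move=> df; have [||s _] := @MVT R f (fun=> 0) 0 1 ltr01.
- by move=> s; rewrite in_itv /= => /andP[s0 s1]; apply: df; rewrite !ltW.
- apply: derivable_within_continuous => s; rewrite in_itv /= => s01.
  by have [] := df s s01.
- by rewrite mul0r => /eqP; rewrite subr_eq0 => /eqP.
Qed.

(** Once two terms are dropped, h^2 factors out of a series bounded by a geometric one. *)
Lemma pseries_quadratic (F : R[i] -> R[i]) c (r : R) : 0 < r ->
  (forall h, normc h < r -> has_csum (fun n => c n * h ^+ n) (F h)) ->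
  exists2 r' : R, 0 < r' & exists C : R, forall h, normc h < r' ->
    normc (F h - c 0%N - c 1%N * h) <= C * normc h ^+ 2.
Proof.
move=> r0 cP; have r2 : normc (r / 2)%:C < r by rewrite normc_real gtr0_norm; lra.
have [C0 _ C0P] := has_csum_bounded (cP _ r2).
pose rho := r / 2; have rho0 : 0 < rho by rewrite /rho; lra.
have rh : 0 <= rho / 2 < rho by lra.
have cb n : normc (c (n.+2)) * rho ^+ n <= C0 / rho ^+ 2.
  rewrite ler_pdivlMr ?exprn_gt0 // -mulrA -exprD addn2.
  by have := C0P n.+2; rewrite normcM normcX normc_real gtr0_norm.
have bd := geometric_abs_bounded rh cb.
exists (rho / 2); first by lra.
exists (C0 / rho ^+ 2 * rho / (rho - rho / 2)) => h hr.
have hr' : normc h < r by rewrite (lt_trans hr) // /rho; lra.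
have := has_csum_drop 2 (cP h hr').
rewrite !big_ord_recl big_ord0 /= expr0 mulr1 addr0 expr1 /bump /= addn0 opprD addrA.
move=> hs; rewrite [leRHS]mulrC; apply: has_csum_le hs _ => n.
apply: le_trans (ler_wpM2l _ (bd n)); last by rewrite exprn_ge0 ?normc_ge0.
rewrite mulr_sumr ler_sum // => i _; rewrite add2n normcM normcX 2!exprS.
rewrite expr2 -[leRHS]mulrA mulrCA ler_wpM2l ?normc_ge0 // mulrCA ler_wpM2l ?normc_ge0 //.
by rewrite ler_wpM2l ?normc_ge0 // lerXn2r ?nnegrE ?normc_ge0 ?(ltW hr) //; lra.
Qed.

(** Moving s by e moves the argument by e t, so the first-order coefficient yields the derivative t
    c_1 of s |-> G (s t), taken componentwise. *)
Lemma is_derive_ReIm (G : R[i] -> R[i]) z t l (r : R) c : t != 0 -> 0 < r ->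
  (forall h, normc h < r -> has_csum (fun n => c n * h ^+ n) (G (z + h))) ->
  forall s : R, z = s%:C * t -> l = t * c 1%N ->
  is_derive s 1 (fun s : R => complex.Re (G (s%:C * t))) (complex.Re l) /\
  is_derive s 1 (fun s : R => complex.Im (G (s%:C * t))) (complex.Im l).
Proof.
move=> t0 r0 cP s zs lt.
have nt0 : 0 < normc t by rewrite normc_gt0.
have [r' r'0 [C CP]] := pseries_quadratic r0 cP.
have c0 : c 0%N = G z.
  have n0 : normc (0 : R[i]) < r by rewrite normc0.
  have := cP 0 n0; rewrite addr0; apply: has_csum_unique.
  have := @has_csum_finite R (fun n => c n * 0 ^+ n) 1%N.
  rewrite big_ord1 expr0 mulr1; apply=> -[//|n] _.
  by rewrite expr0n mulr0.
have key (e : R) : `|e| < r' / normc t ->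
    normc (G ((s + e)%:C * t) - G (s%:C * t) - e%:C * l) <= C * normc t ^+ 2 * e ^+ 2.
  rewrite ltr_pdivlMr // => er.
  have et : normc (e%:C * t) < r' by rewrite normcM normc_real.
  have := CP _ et; rewrite -zs c0 normcM normc_real exprMn real_normK ?num_real //.
  rewrite [C * _ * _]mulrAC -[C * _ * _]mulrA; congr (normc _ <= _).
  by rewrite rmorphD mulrDl -zs lt; ring.
have rt0 : 0 < r' / normc t by rewrite divr_gt0.
split; apply: (is_derive_quadratic rt0) => e /key; apply: le_trans.
- apply: le_trans (ler_Re_normc _); rewrite !raddfB /=.
  by case: (l) => a b /=; rewrite mul0r subr0.
- apply: le_trans (ler_Im_normc _); rewrite !raddfB /=.
  by case: (l) => a b /=; rewrite mul0r addr0.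
Qed.

(** In the right half-plane x / |x + i y| is the cosine of atan (y / x), and the sign test in [carg]
    selects the sign of that angle. *)
Lemma carg_atan (x y : R) : 0 < x -> carg (x +i* y) = atan (y / x).
Proof.
move=> x0; pose th := atan (y / x).
have Eth : x / normc (x +i* y) = cos th.
  rewrite cos_atan; have -> : 1 + (y / x) ^+ 2 = (x ^+ 2 + y ^+ 2) / x ^+ 2.
    by field; rewrite gt_eqF.
  rewrite sqrtrM ?addr_ge0 ?sqr_ge0 // sqrtrV ?sqr_ge0 // sqrtr_sqr gtr0_norm //.
  by rewrite invfM invrK mulrC.
have pi0 := pi_ge0 R.
have [h1 h2] : - (pi / 2) < th /\ th < pi / 2 by rewrite atan_gtNpi2 atan_ltpi2.
rewrite /carg -[complex.Re _]/x -[complex.Im _]/y Eth.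
case: ltP => y0.
  have th0 : th < 0.
    by rewrite -atan0 lt_atan // pmulr_llt0 ?invr_gt0.
  by rewrite cosKN ?opprK //; lra.
have th0 : 0 <= th by rewrite -atan0 le_atan // divr_ge0 // ltW.
rewrite cosK // in_itv /=; apply/andP; split; lra.
Qed.

(** Along the segment, 1 - s t has positive real part, so its logarithm is [L1 s] + i [L2 s],
    differentiable without crossing the cut. *)
Lemma binseries_cpow lam t : normc t < 1 -> binseries lam t = cpow (1 - t) (- lam).
Proof.
move=> t1; have [->|t0] := eqVneq t 0.
  rewrite binseries0 subr0 /cpow /clog.
  have -> : (1 : R[i]) = 1 +i* 0 by [].
  rewrite carg_atan // mul0r atan0 normc1 ln1 mulr0.
  by rewrite /cexp /= expR0 cos0 sin0 mulr1 mulr0.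
pose a := complex.Re t; pose b := complex.Im t.
have Et : t = a +i* b by rewrite /a /b; case: (t).
pose X s : R := 1 - s * a; pose Y s : R := - (s * b).
have EXY (s : R) : 1 - s%:C * t = X s +i* Y s.
  by apply/eqP; rewrite Et eq_complex /= !mul0r subr0 addr0 add0r !eqxx.
pose N s := X s ^+ 2 + Y s ^+ 2.
pose L1 s := 2^-1 * ln (N s); pose L2 s := atan (Y s / X s).
have X0 (s : R) : 0 <= s <= 1 -> 0 < X s.
  move=> /andP[s0 s1]; have := ler_Re_normc t; rewrite -/a => ta.
  have aT : a <= normc t by exact: le_trans (ler_norm a) ta.
  have h1 := ler_wpM2l s0 aT; have h2 := ler_wpM2r (normc_ge0 t) s1.
  by rewrite /X; lra.
have N0 (s : R) : 0 <= s <= 1 -> 0 < N s.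
  by move=> /X0 h; rewrite /N ltr_pwDl ?exprn_gt0 ?sqr_ge0.
have dX (s : R) : is_derive s 1 X (- a).
  apply: (@is_derive_quadratic _ _ _ 1 0) => // e _.
  by rewrite /X mul0r (_ : _ - _ = 0) ?normr0 //; ring.
have dY (s : R) : is_derive s 1 Y (- b).
  apply: (@is_derive_quadratic _ _ _ 1 0) => // e _.
  by rewrite /Y mul0r (_ : _ - _ = 0) ?normr0 //; ring.
have dN (s : R) : is_derive s 1 N (- 2 * (a * X s + b * Y s)).
  apply: (@is_derive_quadratic _ _ _ 1 (a ^+ 2 + b ^+ 2)) => // e _.
  rewrite /N /X /Y (_ : _ - _ = (a ^+ 2 + b ^+ 2) * e ^+ 2); last by ring.
  by rewrite ger0_norm // mulr_ge0 ?addr_ge0 ?sqr_ge0.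
have dL1 (s : R) : 0 <= s <= 1 -> is_derive s 1 L1 (- (a * X s + b * Y s) / N s).
  move=> s01; have dl := is_derive1_ln (N0 s s01).
  have dc := is_derive1_comp dl (dN s).
  have := is_deriveZ 2^-1 dc; move=> /is_derive_eq; apply.
  by rewrite /GRing.scale /=; field; rewrite gt_eqF ?N0.
have dL2 (s : R) : 0 <= s <= 1 -> is_derive s 1 L2 ((a * Y s - b * X s) / N s).
  move=> s01; have Xn0 : X s != 0 by rewrite gt_eqF ?X0.
  have dq : is_derive s (1 : R) (fun s : R => Y s / X s) _ :=
    is_deriveM (dY s) (is_deriveV Xn0 (dX s)).
  have := @is_derive1_comp _ (@atan R) (fun s => Y s / X s) s _ _
    (is_derive1_atan (Y s / X s)) dq.
  move=> /is_derive_eq; apply.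
  have XYn0 : X s ^+ 2 + Y s ^+ 2 != 0 by rewrite gt_eqF ?(N0 s).
  by rewrite /GRing.scale /= /N; field; rewrite XYn0 Xn0.
pose l := complex.Re lam; pose m := complex.Im lam.
have Elam : lam = l +i* m by rewrite /l /m; case: (lam).
pose U s : R := complex.Re (binseries lam (s%:C * t)).
pose V s : R := complex.Im (binseries lam (s%:C * t)).
(* [P] and [Q] are the real and imaginary parts of lam log (1 - s t). *)
pose P s : R := l * L1 s - m * L2 s; pose Q s : R := l * L2 s + m * L1 s.
(* [D1] and [D2] are the components of the derivative -t / (1 - s t) of log (1 - s t). *)
pose D1 s : R := - (a * X s + b * Y s) / N s.
pose D2 s : R := (a * Y s - b * X s) / N s.
have dP (s : R) : 0 <= s <= 1 -> is_derive s 1 P (l * D1 s - m * D2 s).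
  by move=> s01; exact: is_deriveB (is_deriveZ l (dL1 s s01)) (is_deriveZ m (dL2 s s01)).
have dQ (s : R) : 0 <= s <= 1 -> is_derive s 1 Q (l * D2 s + m * D1 s).
  by move=> s01; exact: is_deriveD (is_deriveZ l (dL2 s s01)) (is_deriveZ m (dL1 s s01)).
(* Componentwise form of b' = lam t / (1 - s t) b for b(s) = [binseries lam (s%:C * t)], read off
   the first-order Taylor coefficient. *)
have dUV (s : R) : 0 <= s <= 1 ->
    is_derive s 1 U (- (U s * (l * D1 s - m * D2 s) - V s * (l * D2 s + m * D1 s))) /\
    is_derive s 1 V (- (U s * (l * D2 s + m * D1 s) + V s * (l * D1 s - m * D2 s))).
  move=> s01; have st1 : normc (s%:C * t) < 1.
    move: s01 => /andP[s0 s1]; rewrite normcM normc_real ger0_norm //.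
    by rewrite (le_lt_trans _ t1) // ler_piMl // normc_ge0.
  have r0 : 0 < 1 - normc (s%:C * t) by rewrite subr_gt0.
  have rc h : normc h < 1 - normc (s%:C * t) ->
      has_csum (fun n => binseries_coef lam (s%:C * t) n * h ^+ n)
        (binseries lam (s%:C * t + h)).
    by move=> hr; apply: binseries_recenter; lra.
  have E : t * binseries_coef lam (s%:C * t) 1 =
     (- (U s * (l * D1 s - m * D2 s) - V s * (l * D2 s + m * D1 s))) +i*
     (- (U s * (l * D2 s + m * D1 s) + V s * (l * D1 s - m * D2 s))).
    have q : t / (1 - s%:C * t) = (- D1 s) +i* (- D2 s).
      apply: (mulIf (sub1_neq0 st1)); rewrite divfK ?sub1_neq0 // EXY {1}Et.
      have Nn0 : N s != 0 by rewrite gt_eqF ?N0.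
      apply/eqP; rewrite eq_complex /=; apply/andP; split; apply/eqP; rewrite /D1 /D2.
        by rewrite -[LHS](mulfK Nn0) {1}/N; field.
      by rewrite -[LHS](mulfK Nn0) {1}/N; field.
    have -> : t * binseries_coef lam (s%:C * t) 1 =
        binseries lam (s%:C * t) * lam * (t / (1 - s%:C * t)).
      rewrite /binseries_coef /bincoef pochS poch0 factS fact0 muln1 divr1 expr1; ring.
    have -> : binseries lam (s%:C * t) = U s +i* V s by rewrite /U /V; case: binseries.
    rewrite q Elam; apply/eqP; rewrite eq_complex /=.
    by apply/andP; split; apply/eqP; ring.
  have [h1 h2] := is_derive_ReIm t0 r0 rc (erefl (s%:C * t)) (esym E).
  by split.
(* [expR (P s) * (cos (Q s) +i* sin (Q s))] is (1 - s t)^lam; its product with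
   the binomial series has zero derivative in [s]. *)
pose W1 s : R := expR (P s) * (U s * cos (Q s) - V s * sin (Q s)).
pose W2 s : R := expR (P s) * (U s * sin (Q s) + V s * cos (Q s)).
have dW1 (s : R) : 0 <= s <= 1 -> is_derive s 1 W1 0.
  move=> s01; have [dU dV] := dUV s s01.
  have dE : is_derive s 1 (fun s : R => expR (P s)) (expR (P s) * (l * D1 s - m * D2 s)) :=
    is_derive1_comp (is_derive_expR (P s)) (dP s s01).
  have dC : is_derive s 1 (fun s : R => cos (Q s)) (- sin (Q s) * (l * D2 s + m * D1 s)) :=
    is_derive1_comp (is_derive_cos (Q s)) (dQ s s01).
  have dS : is_derive s 1 (fun s : R => sin (Q s)) (cos (Q s) * (l * D2 s + m * D1 s)) :=
    is_derive1_comp (is_derive_sin (Q s)) (dQ s s01).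
  have dF : is_derive s (1 : R) (fun s : R => U s * cos (Q s) - V s * sin (Q s)) _ :=
    is_deriveB (is_deriveM dU dC) (is_deriveM dV dS).
  have := is_deriveM dE dF.
  by move=> /is_derive_eq; apply; rewrite /GRing.scale /=; ring.
have dW2 (s : R) : 0 <= s <= 1 -> is_derive s 1 W2 0.
  move=> s01; have [dU dV] := dUV s s01.
  have dE : is_derive s 1 (fun s : R => expR (P s)) (expR (P s) * (l * D1 s - m * D2 s)) :=
    is_derive1_comp (is_derive_expR (P s)) (dP s s01).
  have dC : is_derive s 1 (fun s : R => cos (Q s)) (- sin (Q s) * (l * D2 s + m * D1 s)) :=
    is_derive1_comp (is_derive_cos (Q s)) (dQ s s01).
  have dS : is_derive s 1 (fun s : R => sin (Q s)) (cos (Q s) * (l * D2 s + m * D1 s)) :=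
    is_derive1_comp (is_derive_sin (Q s)) (dQ s s01).
  have dF : is_derive s (1 : R) (fun s : R => U s * sin (Q s) + V s * cos (Q s)) _ :=
    is_deriveD (is_deriveM dU dS) (is_deriveM dV dC).
  have := is_deriveM dE dF.
  by move=> /is_derive_eq; apply; rewrite /GRing.scale /=; ring.
have [L10 L20] : L1 0 = 0 /\ L2 0 = 0.
  by rewrite /L1 /L2 /N /X /Y !mul0r oppr0 addr0 mul0r atan0 expr1n expr0n addr0 ln1 mulr0.
have [P0 Q0] : P 0 = 0 /\ Q 0 = 0 by rewrite /P /Q L10 L20 !mulr0 subr0 addr0.
have [U0 V0] : U 0 = 1 /\ V 0 = 0 by rewrite /U /V mul0r binseries0.
have w1 : W1 1 = 1.
  by rewrite (is_derive0_eq dW1) /W1 P0 Q0 U0 V0 expR0 cos0 mul0r subr0 !mulr1.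
have w2 : W2 1 = 0.
  by rewrite (is_derive0_eq dW2) /W2 P0 Q0 U0 V0 sin0 mul0r mulr0 addr0 mulr0.
have i01 : 0 <= (1 : R) <= 1 by rewrite ler01 lexx.
have E1 : 1 - t = X 1 +i* Y 1 by rewrite -EXY mul1r.
have clogE : clog (1 - t) = L1 1 +i* L2 1.
  rewrite /clog E1 carg_atan ?X0 // /= -/(N 1); congr (_ +i* _).
  have N1 := N0 1 i01; rewrite /L1 -{2}(sqr_sqrtr (ltW N1)) lnXn ?sqrtr_gt0 //.
  by rewrite -mulr_natl; field.
have -> : binseries lam t = U 1 +i* V 1 by rewrite /U /V mul1r; case: binseries.
rewrite /cpow clogE /cexp Elam.
have -> : - (l +i* m) * (L1 1 +i* L2 1) = (- P 1) +i* (- Q 1).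
  by apply/eqP; rewrite eq_complex /= /P /Q; apply/andP; split; apply/eqP; ring.
rewrite /= expRN cosN sinN.
have e0 : expR (P 1) != 0 by rewrite gt_eqF ?expR_gt0.
have cs := cos2Dsin2 (Q 1).
(* The rotation by [Q 1] and the scaling by [expR (P 1)] are inverted to recover [U 1] and [V 1]
   from [W1 1] and [W2 1]. *)
have u1 : U 1 = (expR (P 1))^-1 * (W1 1 * cos (Q 1) + W2 1 * sin (Q 1)).
  transitivity (U 1 * (cos (Q 1) ^+ 2 + sin (Q 1) ^+ 2)); first by rewrite cs mulr1.
  by rewrite /W1 /W2; field.
have v1 : V 1 = (expR (P 1))^-1 * (W2 1 * cos (Q 1) - W1 1 * sin (Q 1)).
  transitivity (V 1 * (cos (Q 1) ^+ 2 + sin (Q 1) ^+ 2)); first by rewrite cs mulr1.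
  by rewrite /W1 /W2; field.
by rewrite u1 v1 w1 w2 !mul0r !mul1r addr0 sub0r.
Qed.

End principal_branch.

(** * Passage to the endpoint, and Pochhammer identities *)

Section generating_functions.
Context {R : realType}.
Implicit Types (z t q lam a b : R[i]) (B T : nat -> R[i]).

Lemma koebe_ratioE (kappa d : nat) t (s : R) : normc t < 1 -> 0 <= s < 1 ->
  (s%:C * t) ^+ d / (1 - s%:C * t) ^+ (kappa * d) =
  t ^+ d / (1 - t) ^+ (kappa * d) * koebe_ratio kappa t s ^+ d.
Proof.
move=> t1 /andP[s0 s1].
have st1 : normc (s%:C * t) < 1.
  by rewrite normcM normc_real ger0_norm // (le_lt_trans _ t1) // ler_piMl ?normc_ge0 // ltW.
have n1 := expf_neq0 (kappa * d) (sub1_neq0 t1).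
have n2 := expf_neq0 (kappa * d) (sub1_neq0 st1).
rewrite /koebe_ratio exprMn [in RHS]exprMn -exprM expr_div_n.
by field; rewrite n1 n2.
Qed.

(** Factoring 1 - q^d = (1 - q) (1 + q + ... + q^(d-1)) with |q| < 1 costs a factor d, and |q^d| <=
    |q| preserves the other estimate. *)
Lemma koebe_ratio_exp_stolz (kappa d : nat) t :
  (0 < d)%N -> (kappa <= 2)%N -> normc t < 1 ->
  exists K : R, forall s : R, 0 <= s < 1 ->
    [/\ normc (1 - koebe_ratio kappa t s ^+ d) <= K * (1 - s),
        1 - s <= K * (1 - normc (koebe_ratio kappa t s ^+ d)) &
        normc (koebe_ratio kappa t s ^+ d) < 1].
Proof.
move=> d0 k2 t1; have [K KP] := koebe_ratio_stolz k2 t1.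
exists (K * d%:R) => s s01; have [h1 h2] := KP s s01.
have s1 : 0 < 1 - s by rewrite subr_gt0; case/andP: s01.
move: (koebe_ratio _ _ _) h1 h2 => q h1 h2.
have q0 := normc_ge0 q; have K0 : 0 <= K.
  by rewrite -(@pmulr_lge0 _ (1 - s)) // (le_trans _ h1) // normc_ge0.
have {}K0 : 0 < K.
  by rewrite lt_neqAle K0 andbT; apply: contraTneq h2 => <-; rewrite mul0r -ltNge.
have q1 : normc q < 1 by rewrite -subr_gt0 -(@pmulr_rgt0 _ K) // (lt_le_trans s1).
have d1 : 1 <= d%:R :> R by rewrite ler1n.
have qd : normc (q ^+ d) <= normc q.
  by rewrite normcX -{2}[normc q]expr1 ler_wiXn2l // ltW.
split; last exact: le_lt_trans qd q1.
  rewrite mulrAC; apply: le_trans (ler_wpM2r (ler0n _ d) h1).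
  rewrite -opprB normcN subrX1 normcM -normcN opprB ler_wpM2l ?normc_ge0 //.
  rewrite (le_trans (normc_sum _ _ _)) // -[leRHS]mulr1 mulr_natl.
  rewrite -[X in _ *+ X]card_ord -sumr_const ler_sum // => i _.
  by rewrite normcX exprn_ile1 // ltW.
rewrite (le_trans h2) // -mulrA ler_wpM2l ?(ltW K0) //.
have : 0 <= 1 - normc q by lra.
nra.
Qed.

Lemma transform_sum lam (d kappa : nat) B t :
  (0 < d)%N -> (kappa <= 2)%N -> normc t < 1 ->
  csummable (fun n => transform_coef lam d (kappa * d) B n * t ^+ n) ->
  csummable (fun m => B m * (t ^+ d / (1 - t) ^+ (kappa * d)) ^+ m) ->
  csum (fun n => transform_coef lam d (kappa * d) B n * t ^+ n) =
  cpow (1 - t) (- lam) * csum (fun m => B m * (t ^+ d / (1 - t) ^+ (kappa * d)) ^+ m).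
Proof.
move=> d0 k2 t1 /csummable_has_csum hG /csummable_has_csum hF.
rewrite -binseries_cpow //.
(* At t = 0 one has y = 0, which provides no radius for the coefficients [B]; both sides reduce to
   [B 0]. *)
have [t0|t0] := eqVneq t 0.
  have z0 (u : nat -> R[i]) : csum (fun n => u n * 0 ^+ n) = u 0%N.
    apply: has_csum_csum; have := @has_csum_finite R (fun n => u n * 0 ^+ n) 1%N.
    by rewrite big_ord1 expr0 mulr1; apply=> -[//|n] _; rewrite expr0n mulr0.
  rewrite t0 expr0n gtn_eqF // mul0r !z0 binseries0 mul1r /transform_coef.
  by rewrite big_ord1 !muln0 leqnn bincoef0 mulr1.
set y := t ^+ d / _ in hF *; set g := transform_coef _ _ _ _ in hG *.
have y0 : 0 < normc y.
  by rewrite normc_gt0 mulf_neq0 ?invr_eq0 ?expf_neq0 // sub1_neq0.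
have [K KP] := koebe_ratio_exp_stolz d0 k2 t1.
have [C _ gC] := has_csum_bounded hG; have [C' _ BC] := has_csum_bounded hF.
have st1 (s : R) : 0 <= s < 1 -> normc (s%:C * t) < 1.
  move=> /andP[s0 s1]; rewrite normcM normc_real ger0_norm //.
  by rewrite (le_lt_trans _ t1) // ler_piMl ?normc_ge0 // ltW.
have stolz1 (s : R) : 0 <= s < 1 ->
    normc (1 - s%:C) <= 1 * (1 - s) /\ 1 - s <= 1 * (1 - normc s%:C).
  move=> /andP[s0 s1]; rewrite !mul1r normc_real ger0_norm //.
  by rewrite -[1]/(1%:C) -rmorphB normc_real ger0_norm // subr_ge0 ltW.
pose p (s : R) := koebe_ratio kappa t s ^+ d.
have yE (s : R) : 0 <= s < 1 ->
    (s%:C * t) ^+ d / (1 - s%:C * t) ^+ (kappa * d) = y * p s.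
  by move=> s01; rewrite koebe_ratioE.
have yP (s : R) : 0 <= s < 1 ->
    normc ((s%:C * t) ^+ d / (1 - s%:C * t) ^+ (kappa * d)) < normc y.
  by move=> s01; rewrite yE // normcM -[ltRHS]mulr1 ltr_pM2l //; have [] := KP s s01.
pose F s := csum (fun m => B m * y ^+ m * p s ^+ m).
have hFs (s : R) : 0 <= s < 1 -> has_csum (fun m => B m * y ^+ m * p s ^+ m) (F s).
  move=> s01; have [_ _ ps1] := KP s s01.
  have X : 0 <= normc (p s) < 1 by rewrite normc_ge0.
  have BC1 m : normc (B m * y ^+ m) * 1 ^+ m <= C' by rewrite expr1n mulr1.
  exact: abs_bounded_has_csum (bounded_at_abs (geometric_abs_bounded X BC1) (lexx _)).
pose b s := binseries lam (s%:C * t).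
have hb (s : R) : 0 <= s < 1 -> has_csum (fun n => bincoef lam n * t ^+ n * s%:C ^+ n) (b s).
  move=> s01; apply: has_csum_eq (binseriesP lam (st1 s s01)) => n.
  by rewrite exprMn; ring.
pose G s := csum (fun n => g n * (s%:C * t) ^+ n).
have GE (s : R) : 0 <= s < 1 -> G s = b s * F s.
  move=> s01; rewrite /G (transform_segment d0 t0 t1 gC BC s01 yP) /transform.
  apply: has_csum_csum; have := has_csumZ (b s) (hFs s s01); apply: has_csum_eq => m.
  by rewrite transform_term ?st1 // yE // [(y * p s) ^+ m]exprMn /b; ring.
have hGs (s : R) : 0 <= s < 1 -> has_csum (fun n => g n * t ^+ n * s%:C ^+ n) (G s).
  move=> s01; have := st1 s s01; move=> _.
  have X : 0 <= normc s%:C < 1.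
    by rewrite normc_real; case/andP: s01 => s0 s1; rewrite ger0_norm // s0.
  have gC1 n : normc (g n * t ^+ n) * 1 ^+ n <= C by rewrite expr1n mulr1.
  rewrite /G (_ : (fun n => g n * (s%:C * t) ^+ n) = (fun n => g n * t ^+ n * s%:C ^+ n)).
    exact: abs_bounded_has_csum (bounded_at_abs (geometric_abs_bounded X gC1) (lexx _)).
  by apply/funext => n; rewrite exprMn; ring.
(* Abel's theorem is applied three times along s = [to_one j]: radially to the left side and to the
   binomial series, and along the path [p] to the series in y. *)
have l1 := abel_limit hG stolz1 hGs.
have l2 := abel_limit (binseriesP lam t1) stolz1 hb.
have l3 : ccvg (F \o to_one) (csum (fun m => B m * y ^+ m)).
  by apply: abel_limit hF _ hFs => s /KP[h1 h2 _]; split; eassumption.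
apply: ccvg_unique l1 _; apply: ccvg_eq (ccvgM l2 l3) => j.
by rewrite /= GE // to_one01.
Qed.

(** The division-free form lets the induction run past k = n, where the factor -n + n makes the left
    side vanish. *)
Lemma poch_neg n k :
  poch (- n%:R : R[i]) k * (n - k)`!%:R = if (k <= n)%N then (-1) ^+ k * n`!%:R else 0.
Proof.
elim: k => [|k IH]; first by rewrite poch0 subn0 expr0.
have [kn|nk] := leqP k.+1 n; last first.
  have -> : poch (- n%:R : R[i]) k.+1 = 0; last by rewrite mul0r.
  rewrite /poch (bigD1 (Ordinal nk)) //= addrC subrr mul0r //.
move: IH; rewrite ltnW // => IH; rewrite exprS -mulrA -IH pochS.
have -> : (n - k = (n - k.+1).+1)%N by rewrite subnSK.
have -> : - n%:R + k%:R = - (n - k.+1).+1%:R :> R[i].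
  by rewrite subnSK // natrB 1?ltnW // opprB addrC.
rewrite factS natrM; ring.
Qed.

Lemma poch_neg0 n k : (n < k)%N -> poch (- n%:R : R[i]) k = 0.
Proof.
move=> nk; have /eqP := poch_neg n k; rewrite leqNgt nk /= mulf_eq0.
by rewrite (negPf (fact_neq0 _ _)) orbF => /eqP.
Qed.

Lemma bincoef_poch_neg lam n k : (k <= n)%N ->
  bincoef lam n * poch (- n%:R) k = (-1) ^+ k * poch lam n / (n - k)`!%:R.
Proof.
move=> kn; have := poch_neg n k; rewrite kn /= => E.
have f1 := fact_neq0 R[i] n; have f2 := fact_neq0 R[i] (n - k).
have -> : poch (- n%:R : R[i]) k = (-1) ^+ k * n`!%:R / (n - k)`!%:R.
  by rewrite -E mulfK.
by rewrite /bincoef; field; rewrite f1 f2.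
Qed.

(** Reversing the order of the factors turns 1 - a - k + (k - 1 - i) into -(a + i). *)
Lemma poch_reflect a k : poch (1 - a - k%:R) k = (-1) ^+ k * poch a k.
Proof.
have -> : (-1) ^+ k * poch a k = \prod_(i < k) - (a + i%:R).
  by rewrite prodrN card_ord.
rewrite /poch (reindex_inj rev_ord_inj) /=; apply: eq_bigr => i _.
by rewrite natrB // -natr1; ring.
Qed.

Lemma poch_neq0 b m : ~ nonpos_int b -> poch b m != 0.
Proof.
move=> hb; apply/prodf_neq0 => i _; apply/eqP => bi; apply: hb.
by exists i; apply/eqP; rewrite -addr_eq0 bi.
Qed.

(** Multiplication formula: passing from m to m + 1 brings in (a + j) / N + m = (a + N m + j) / N
    for j < N, that is, the next N factors of (a)_(N m), each divided by N. *)
Lemma prod_poch_Delta (N : nat) a m : (0 < N)%N ->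
  \prod_(c <- Delta N a) poch c m = poch a (N * m) / N%:R ^+ (N * m).
Proof.
move=> N0; have Nn0 : N%:R != 0 :> R[i] by rewrite pnatr_eq0 -lt0n.
have E : iota 0 N = index_iota 0 N by rewrite /index_iota subn0.
rewrite /Delta big_map E big_mkord.
elim: m => [|m IH].
  by rewrite muln0 poch0 divr1 big1 // => i _; rewrite poch0.
under eq_bigr do rewrite pochS.
rewrite big_split /= IH mulnS addnC pochD exprD invfM mulrACA; congr (_ * _).
have -> : N%:R ^- N = \prod_(j < N) (N%:R : R[i])^-1.
  by rewrite prodr_const card_ord exprVn.
rewrite /poch -big_split /=.
by apply: eq_bigr => i _; rewrite natrM; field.
Qed.

(** The interface shared by the three identities: [A n m] is the m-th inner term, zero once N m > n,
    and the coefficient relation turns each outer term into [transform_coef]. *)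
Lemma generating_sum lam (N kappa : nat) t (A : nat -> nat -> R[i]) B T :
  (0 < N)%N -> (kappa <= 2)%N -> normc t < 1 ->
  (forall n m, (n < N * m)%N -> A n m = 0) ->
  (forall n m, (N * m <= n)%N ->
     bincoef lam n * A n m = B m * bincoef (lam + (kappa * N * m)%:R) (n - N * m)) ->
  (forall m, T m = B m * (t ^+ N / (1 - t) ^+ (kappa * N)) ^+ m) ->
  csummable (fun n => bincoef lam n * csum (A n) * t ^+ n) -> csummable T ->
  csum (fun n => bincoef lam n * csum (A n) * t ^+ n) = cpow (1 - t) (- lam) * csum T.
Proof.
move=> N0 k2 t1 A0 AB /funext -> .
have -> : (fun n => bincoef lam n * csum (A n) * t ^+ n) =
    (fun n => transform_coef lam N (kappa * N) B n * t ^+ n).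
  apply/funext => n; congr (_ * _).
  have -> : csum (A n) = \sum_(m < n.+1) A n m.
    apply: has_csum_csum; apply: has_csum_finite => m nm; apply: A0.
    by rewrite (leq_trans nm) // leq_pmull.
  rewrite mulr_sumr; apply: eq_bigr => m _.
  by case: leqP => h; [exact: AB|rewrite A0 // !mulr0].
exact: transform_sum.
Qed.

End generating_functions.

(** * The hypergeometric terms and the three identities *)

Lemma eihg_term_cat (R : realType) (aa aa' bb bb' : seq R[i]) (a1 : R[i]) (x p : R) z m :
  eihg_term (aa ++ aa') a1 x p (bb ++ bb') z m =
  (\prod_(a <- aa) poch a m) / (\prod_(b <- bb) poch b m) * eihg_term aa' a1 x p bb' z m.
Proof.
rewrite /eihg_term !big_cat /= invfM.
move: (\prod_(_ <- aa) _) (\prod_(_ <- aa') _) (ipoch _ _ _ _) => A A' I.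
move: (\prod_(_ <- bb) _)^-1 (\prod_(_ <- bb') _)^-1 (z ^+ m / _) => D D' Z; ring.
Qed.

(** Applied to the alpha and beta parameters, [c] gathers the factors shared by both sides of each
    identity, leaving only the Delta arrays and the power of z to compare. *)
Lemma eihg_term_coef (R : realType) (aa bb : seq R[i]) (a1 : R[i]) (x p : R) :
  exists c, forall z m, eihg_term aa a1 x p bb z m = c m * z ^+ m.
Proof.
exists (eihg_term aa a1 x p bb 1) => z m.
by rewrite /eihg_term expr1n mul1r -[RHS]mulrA [_^-1 * z ^+ m]mulrC.
Qed.

Lemma sqr_sign (F : pzRingType) k : (-1) ^+ k * (-1) ^+ k = 1 :> F.
Proof. by rewrite -exprD addnn -mul2n exprM sqrrN !expr1n. Qed.

Theorem theorem5 (R : realType) (r s : nat) (hr : (1 <= r)%N)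
    (alpha1 : R[i]) (alpha : (r.-1).-tuple R[i]) (beta : s.-tuple R[i])
    (hbeta : forall b, b \in beta -> ~ nonpos_int b)
    (x p : R) (hx : 0 <= x) (hp : 0 <= p)
    (halpha1 : p = 0 -> x = 0 -> 0 < complex.Re alpha1)
    (t : R[i]) (ht : `|t| < 1) (lambda : R[i]) (N : nat) (hN : (0 < N)%N)
    (z : R[i]) :
  [/\ (let L n := eihg (Delta N (- n%:R) ++ alpha) alpha1 x p beta z in
       let w := z * (- (t / (1 - t))) ^+ N in
       (forall n : nat,
          eihg_exists (Delta N (- n%:R) ++ alpha) alpha1 x p beta z) ->
       csummable (fun n => poch lambda n / n`!%:R * L n * t ^+ n) ->
       eihg_exists (Delta N lambda ++ alpha) alpha1 x p beta w ->
       csum (fun n => poch lambda n / n`!%:R * L n * t ^+ n) =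
       cpow (1 - t) (- lambda) *
       eihg (Delta N lambda ++ alpha) alpha1 x p beta w),
      (let L n := eihg (Delta N (- n%:R) ++ Delta N (lambda + n%:R) ++ alpha)
                       alpha1 x p beta z in
       let w := z * (- (4%:R * t / (1 - t) ^+ 2)) ^+ N in
       (forall n : nat,
          eihg_exists (Delta N (- n%:R) ++ Delta N (lambda + n%:R) ++ alpha)
                      alpha1 x p beta z) ->
       csummable (fun n => poch lambda n / n`!%:R * L n * t ^+ n) ->
       eihg_exists (Delta (2 * N) lambda ++ alpha) alpha1 x p beta w ->
       csum (fun n => poch lambda n / n`!%:R * L n * t ^+ n) =
       cpow (1 - t) (- lambda) *
       eihg (Delta (2 * N) lambda ++ alpha) alpha1 x p beta w)
    & (let L n := eihg (Delta N (- n%:R) ++ alpha) alpha1 x p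
                       (Delta N (1 - lambda - n%:R) ++ beta) z in
       let w := z * t ^+ N in
       (forall n : nat,
          eihg_exists (Delta N (- n%:R) ++ alpha) alpha1 x p
                      (Delta N (1 - lambda - n%:R) ++ beta) z) ->
       csummable (fun n => poch lambda n / n`!%:R * L n * t ^+ n) ->
       eihg_exists alpha alpha1 x p beta w ->
       csum (fun n => poch lambda n / n`!%:R * L n * t ^+ n) =
       cpow (1 - t) (- lambda) * eihg alpha alpha1 x p beta w)].
Proof.
have t1 : normc t < 1 by rewrite -ltcR -normcC.
have Nn0 : N%:R != 0 :> R[i] by rewrite pnatr_eq0 -lt0n.
have NX k : N%:R ^+ k != 0 :> R[i] by rewrite expf_neq0.
have [c cE] := eihg_term_coef alpha beta alpha1 x p.
have numE aa y m : eihg_term (aa ++ alpha) alpha1 x p beta y m =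
    (\prod_(a <- aa) poch a m) * (c m * y ^+ m).
  by rewrite -[X in eihg_term _ _ _ _ X]cat0s eihg_term_cat big_nil divr1 cE.
split=> L w hL hS [_ hR].
(* [B] comes from (lambda)_n = (lambda)_(N m) (lambda + N m)_(n - N m); its sign (-1)^(N m) stems
   from (-n)_(N m) and is absorbed by the one in w. *)
- apply: (@generating_sum _ lambda N 1 t
    (fun n => eihg_term (Delta N (- n%:R) ++ alpha) alpha1 x p beta z)
    (fun m => poch lambda (N * m) * (-1) ^+ (N * m) / N%:R ^+ (N * m) * (c m * z ^+ m))).
  + exact: hN.
  + exact: isT.
  + exact: t1.
  + by move=> n m nm; rewrite numE prod_poch_Delta // poch_neg0 // !mul0r.
  + move=> n m nm; rewrite numE prod_poch_Delta // mul1n.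
    have F : poch lambda n = poch lambda (N * m) * poch (lambda + (N * m)%:R) (n - N * m).
      by rewrite -pochD subnKC.
    rewrite !mulrA (bincoef_poch_neg _ nm) F /bincoef.
    move: (poch lambda _) (poch (lambda + _) _) ((n - N * m)`!%:R)^-1 => P Q f.
    move: (N%:R ^- _) ((-1) ^+ _) (c m) (z ^+ m) => d e y v; ring.
  + move=> m; rewrite numE prod_poch_Delta // mul1n.
    have -> : w ^+ m = (-1) ^+ (N * m) * (z ^+ m * (t ^+ N / (1 - t) ^+ N) ^+ m).
      rewrite /w -expr_div_n exprMn -exprM (exprNn (t / (1 - t))) -[in RHS]exprM.
      by rewrite mulrCA.
    move: (poch lambda _) (N%:R ^- _) ((-1) ^+ _) (c m) (z ^+ m) (_ ^+ m) => a d e y v u.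
    ring.
  + exact: hS.
  + exact: hR.
(* Here (lambda)_n (lambda + n)_(N m) and (lambda)_(2 N m) (lambda + 2 N m)_(n - N m) are two
   splittings of (lambda)_(n + N m). *)
- apply: (@generating_sum _ lambda N 2 t
    (fun n => eihg_term (Delta N (- n%:R) ++ Delta N (lambda + n%:R) ++ alpha) alpha1 x p beta z)
    (fun m => poch lambda (2 * N * m) * (-1) ^+ (N * m) / N%:R ^+ (2 * N * m) * (c m * z ^+ m))).
  + exact: hN.
  + exact: isT.
  + exact: t1.
  + by move=> n m nm; rewrite catA numE big_cat /= prod_poch_Delta // poch_neg0 // !mul0r.
  + move=> n m nm; rewrite catA numE big_cat /= !prod_poch_Delta //.
    have E := bincoef_poch_neg lambda nm.
    have F : poch lambda n * poch (lambda + n%:R) (N * m) =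
        poch lambda (2 * N * m) * poch (lambda + (2 * N * m)%:R) (n - N * m).
      by rewrite -!pochD; congr poch; lia.
    have -> : N%:R ^+ (2 * N * m) = N%:R ^+ (N * m) * N%:R ^+ (N * m) :> R[i].
      by rewrite -exprD; congr (_ ^+ _); lia.
    rewrite invfM [RHS]mulrAC -/(bincoef _ _) /(bincoef (lambda + _) _).
    move: (bincoef lambda n) (poch (- n%:R) _) E F => b P E.
    move: (poch lambda n) (poch (lambda + n%:R) _) E => a Q E.
    move: (poch lambda (2 * N * m)) (poch (lambda + (2 * N * m)%:R) _) => a2 Q2 F.
    move: ((n - N * m)`!%:R)^-1 E => f E.
    move: (N%:R ^- _) ((-1) ^+ _) (c m) (z ^+ m) E => d e y v E.
    transitivity ((b * P) * Q * d * d * y * v); first by ring.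
    rewrite E; transitivity (e * (a * Q) * f * d * d * y * v); first by ring.
    by rewrite F; ring.
  + move=> m; rewrite numE prod_poch_Delta ?muln_gt0 //.
    (* The 4^(N m) in w^m is written as 2^(2 N m) in order to cancel against the (2 N)^(2 N m)
       produced by Delta(2N; lambda). *)
    have -> : w ^+ m = (-1) ^+ (N * m) * (2%:R ^+ (2 * N * m) * (z ^+ m *
        (t ^+ N / (1 - t) ^+ (2 * N)) ^+ m)).
      have E : 2%:R ^+ (2 * N * m) = 4%:R ^+ (N * m) :> R[i].
        by rewrite -mulnA exprM -natrX.
      have F : t ^+ N / (1 - t) ^+ (2 * N) = (t / (1 - t) ^+ 2) ^+ N.
        by rewrite expr_div_n -exprM.
      rewrite E F /w exprMn -!exprM -mulrA (exprNn (4%:R * _)) (exprMn _ 4%:R).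
      move: (_ ^+ (N * m)) (_ ^+ (N * m)) (_ ^+ (N * m)) (z ^+ m) => *; ring.
    have n2 : 2%:R ^+ (2 * N * m) != 0 :> R[i] by rewrite expf_neq0 // pnatr_eq0.
    have -> : (2 * N)%:R ^+ (2 * N * m) = 2%:R ^+ (2 * N * m) * N%:R ^+ (2 * N * m) :> R[i].
      by rewrite natrM exprMn.
    move: n2 (NX (2 * N * m)).
    move: (2%:R ^+ _) (N%:R ^+ _) => d2 d n2 n1.
    move: (poch lambda _) ((-1) ^+ _) (c m) (z ^+ m) ((t ^+ N / _) ^+ m) => a e y v u.
    by field; rewrite n2 n1.
  + exact: hS.
  + exact: hR.
(* By reflection the denominator array removes N m factors from (lambda)_n, leaving (lambda)_(n - N
   m); signs and powers of N cancel, so the exponent stays lambda. *)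
- apply: (@generating_sum _ lambda N 0 t
    (fun n => eihg_term (Delta N (- n%:R) ++ alpha) alpha1 x p
                (Delta N (1 - lambda - n%:R) ++ beta) z)
    (fun m => c m * z ^+ m)).
  + exact: hN.
  + exact: isT.
  + exact: t1.
  + by move=> n m nm; rewrite eihg_term_cat prod_poch_Delta // poch_neg0 // !mul0r.
  + move=> n m nm; rewrite eihg_term_cat cE !prod_poch_Delta // mul0n addr0.
    (* Admissibility of the denominator parameters, part of the existence of the n-th inner series,
       makes this division legitimate. *)
    have Q0 : poch (1 - lambda - n%:R) (N * m) != 0.
      have : \prod_(b <- Delta N (1 - lambda - n%:R)) poch b m != 0.
        rewrite prodf_seq_neq0; apply/allP => b bD /=; apply: poch_neq0.
        by have [hb _] := hL n; apply: hb; rewrite mem_cat bD.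
      by rewrite prod_poch_Delta //; apply: contraNneq => ->; rewrite mul0r.
    have E := bincoef_poch_neg lambda nm.
    have F : poch lambda n = poch lambda (n - N * m) *
        ((-1) ^+ (N * m) * poch (1 - lambda - n%:R) (N * m)).
      rewrite -{1}(subnK nm) pochD; congr (_ * _).
      have -> : 1 - lambda - n%:R = 1 - (lambda + (n - N * m)%:R) - (N * m)%:R.
        by rewrite natrB //; ring.
      by rewrite poch_reflect mulrA sqr_sign mul1r.
    rewrite [in RHS]/bincoef; move: (sqr_sign R[i] (N * m)) (NX (N * m)%N) E F Q0.
    move: (bincoef lambda n) (poch (- n%:R) _) (poch (1 - lambda - n%:R) _) => b P Q.
    move: (poch lambda n) (poch lambda (n - N * m)) ((n - N * m)`!%:R)^-1 => a a' f.
    move: ((-1) ^+ _) (N%:R ^+ _) (c m) (z ^+ m) => e d y v ee d0 E F Q0.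
    transitivity ((b * P) / Q * (y * v)); first by field; rewrite d0 Q0.
    rewrite E F; transitivity ((e * e) * (a' * f * (y * v))); first by field.
    by rewrite ee; ring.
  + by move=> m; rewrite cE mul0n expr0 divr1 /w exprMn -exprM mulrA.
  + exact: hS.
  + exact: hR.
Qed.
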